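(* Let $\phi\in C^1(X,G)$ and let $\pi$ be a finite-dimensional irreducible unitary representation of $G$. (a) If $\phi=h\circ\delta$ with $G'$ a compact Lie group, $h:G'\to G$ a Lie group homomorphism and $\delta\in C^1(X,G')$, then $$P_\phi M_\phi=(dh)_{e_{G'}}\big((P_\delta M_\delta)(\cdot)\big)\quad\mu_X\hbox{-almost everywhere.}$$ (b) If $\zeta,\delta\in C^1(X,G)$ are such that $\phi(x)=\zeta(x)^{-1}\delta(x)\,\zeta(F_1(x))$ for each $x\in X$, then $P_\delta M_\delta=\mathrm{Ad}_\zeta(P_\phi M_\phi)$ $\mu_X$-almost everywhere. In particular, $$\big\|(P_\delta M_\delta)(x)\big\|_{\mathfrak g}=\big\|(P_\phi M_\phi)(x)\big\|_{\mathfrak g}\quad\hbox{for }\mu_X\hbox{-almost every }x\in X.$$ (c) If $\phi=h\circ\delta$ with $G'$ a compact Lie group, $h:G'\to G$ a Lie group homomorphism and $\delta\in C^1(X,G')$, then $$P_{\pi\circ\phi}M_{\pi\circ\phi}=\big(d(\pi\circ h)\big)_{e_{G'}}\big((P_\delta M_\delta)(\cdot)\big)\quad\mu_X\hbox{-almost everywhere.}$$ (d) If $\zeta,\delta\in C^1(X,G)$ are such that $\phi(x)=\zeta(x)^{-1}\delta(x)\,\zeta(F_1(x))$ for each $x\in X$, then $P_{\pi\circ\delta}M_{\pi\circ\delta}=\mathrm{Ad}_{\pi\circ\zeta}(P_{\pi\circ\phi}M_{\pi\circ\phi})$ $\mu_X$-almost everywhere. In particular, $$\big\|(P_{\pi\circ\delta}M_{\pi\circ\delta})(x)\big\|_{\mathscr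 B(\mathbb C^{d_\pi})}=\big\|(P_{\pi\circ\phi}M_{\pi\circ\phi})(x)\big\|_{\mathscr B(\mathbb C^{d_\pi})}\quad\hbox{for }\mu_X\hbox{-almost every }x\in X.$$
   Context: $X$ is a smooth compact second countable Hausdorff manifold with Borel probability measure $\mu_X$, and $\{F_t\}_{t\in\mathbb R}$ is a $C^1$ flow on $X$ preserving $\mu_X$, with continuous vector field $Y$; $\mathcal L_Yf(x)=\frac{d}{dt}|_{t=0}f(F_t(x))$. $G$ is a compact Lie group with identity $e_G$ and Lie algebra $\mathfrak g$, endowed with an $\mathrm{Ad}$-invariant scalar product $\langle\cdot,\cdot\rangle_{\mathfrak g}$ with norm $\|\cdot\|_{\mathfrak g}$, where $\mathrm{Ad}_gZ=gZg^{-1}$. $L^2(X,\mathfrak g)$ is the Hilbert space of measurable functions $X\to\mathfrak g$ with scalar product $\int_Xd\mu_X\langle f_1,f_2\rangle_{\mathfrak g}$. For a compact Lie group $G$ and $\phi\in C^1(X,G)$: $M_\phi:=\mathcal L_Y\phi\cdot\phi^{-1}:X\to\mathfrak g$ (right translation to $T_{e_G}G\simeq\mathfrak g$); $W_\phi$ is the unitary operator in $L^2(X,\mathfrak g)$ given by $(W_\phi f)(x)=\mathrm{Ad}_{\phi(x)}f(F_1(x))$; $P_\phi$ is the orthogonal projection onto $\ker(1-W_\phi)$. The function $P_\phi M_\phi\in L^2(X,\mathfrak g)$ is called the degree of $\phi$. The same definitions apply with $(G,\phi)$ replaced by $(G',\delta)$, and with $(G,\phi)$ replaced by $(\pi(G),\pi\circ\phi)$,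 where $\pi:G\to\mathrm U(d_\pi)$ (unitary $d_\pi\times d_\pi$ matrices): $\mathfrak g_\pi$ is the Lie algebra of $\pi(G)$, $M_{\pi\circ\phi}=\mathcal L_Y(\pi\circ\phi)\cdot(\pi\circ\phi)^{-1}$, $(W_{\pi\circ\phi}f)(x)=\mathrm{Ad}_{\pi(\phi(x))}f(F_1(x))$ in $L^2(X,\mathfrak g_\pi)$ (for an $\mathrm{Ad}$-invariant scalar product on $\mathfrak g_\pi$), and $P_{\pi\circ\phi}$ is the orthogonal projection onto $\ker(1-W_{\pi\circ\phi})$. $(dh)_{e_{G'}}$ and $(d(\pi\circ h))_{e_{G'}}$ are the differentials at the identity, viewed as maps between Lie algebras. $\mathscr B(\mathbb C^{d_\pi})$ is the space of $d_\pi\times d_\pi$ complex matrices with operator norm. *)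

(* Defs.v *)
(* MathComp-Analysis *)
From HB Require Import structures.
From mathcomp Require Import all_boot all_order all_algebra.
From mathcomp Require Import all_classical all_reals all_analysis.
From mathcomp Require Import complex.
Set Implicit Arguments.
Unset Strict Implicit.
Unset Printing Implicit Defensive.
Import Order.TTheory GRing.Theory Num.Theory.
Import numFieldNormedType.Exports.
Local Open Scope classical_set_scope.
Local Open Scope ring_scope.

(* For V of finite dimension and U open: f is of class C^k on U. *)
Fixpoint Ck (R : realType) (V W : normedModType R) (k : nat) (U : set V)
    (f : V -> W) : Prop :=
  if k is k'.+1 then
    (forall x, U x -> differentiable f x) /\
    (forall v, Ck k' U (fun x => 'D_v f x))
  else forall x, U x -> {for x, continuous f}.

(* The values of [cmap] outside [cdom], and of [cinv] outside
   [cmap @` cdom], are irrelevant. *)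
Record chart (R : realType) (E : normedModType R) (T : topologicalType) :=
  Chart { cdom : set T; cmap : T -> E; cinv : E -> T }.

Definition is_chart (R : realType) (E : normedModType R) (T : topologicalType)
    (c : chart E T) :=
  [/\ open (cdom c), open (cmap c @` cdom c),
      forall x, cdom c x -> cinv c (cmap c x) = x,
      forall x, cdom c x -> {for x, continuous (cmap c)} &
      forall y, (cmap c @` cdom c) y -> {for y, continuous (cinv c)}].

Definition smooth_atlas (R : realType) (E : normedModType R)
    (T : topologicalType) (A : set (chart E T)) :=
  [/\ forall c, A c -> is_chart c,
      forall x, exists c, A c /\ cdom c x &
      forall c d, A c -> A d -> forall k,
        Ck k (cmap c @` (cdom c `&` cdom d)) (cmap d \o cinv c)].

Definition vec_atlas (R : realType) (E : normedModType R) : set (chart E E) :=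
  [set Chart setT id id].
Arguments vec_atlas {R} E.

Definition prod_atlas (R : realType) (E E' : normedModType R)
    (T T' : topologicalType) (A : set (chart E T)) (A' : set (chart E' T')) :
    set (chart (E * E')%type (T * T')%type) :=
  [set c | exists a a', [/\ A a, A' a' &
     c = Chart (cdom a `*` cdom a')
               (fun p => (cmap a p.1, cmap a' p.2))
               (fun q => (cinv a q.1, cinv a' q.2))]].

Definition Ck_map (R : realType) (E E' : normedModType R)
    (T T' : topologicalType) (k : nat)
    (A : set (chart E T)) (A' : set (chart E' T')) (f : T -> T') :=
  continuous f /\
  forall c c', A c -> A' c' ->
    Ck k (cmap c @` (cdom c `&` f @^-1` cdom c')) (cmap c' \o f \o cinv c).

(* Smooth manifolds (without boundary), Hausdorff and second countable; they
   are not assumed compact. *)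
HB.mixin Record isManifold (R : realType) T of PointedTopological T := {
  mdim : nat;
  atlas : set (chart 'rV[R]_mdim T);
  atlas_smooth : smooth_atlas atlas;
  manifold_hausdorff : hausdorff_space T;
  manifold_second_countable : @second_countable T
}.

#[short(type="manifoldType")]
HB.structure Definition Manifold (R : realType) :=
  { T of isManifold R T & PointedTopological T }.

Arguments mdim {R} s : rename.
Arguments atlas {R} s : rename.

HB.mixin Record isLieGroup (R : realType) G of Manifold R G & Group G := {
  lie_mul_smooth : forall k,
    Ck_map k (prod_atlas (atlas G) (atlas G)) (atlas G)
      (fun p : G * G => (p.1 * p.2)%g);
  lie_inv_smooth : forall k,
    Ck_map k (atlas G) (atlas G) (fun x : G => (x^-1)%g)
}.

#[short(type="lieGroupType")]
HB.structure Definition LieGroup (R : realType) :=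
  { G of isLieGroup R G & Manifold R G & Group G }.

Lemma atlas_cover (R : realType) (M : manifoldType R) (x : M) :
  exists c, atlas M c /\ cdom c x.
Proof. by case: (@atlas_smooth R M) => _ + _; exact. Qed.

Definition chart_at (R : realType) (M : manifoldType R) (x : M) :
  chart 'rV[R]_(mdim M) M := sval (cid (atlas_cover x)).

(* The tangent space at x is R^n, through the coordinates of the chart
   [chart_at x] of the atlas. *)
Definition tangent (R : realType) (M : manifoldType R) (x : M) :
  normedModType R := 'rV[R]_(mdim M).

Definition tangent_map (R : realType) (M N : manifoldType R) (f : M -> N)
    (x : M) : tangent x -> tangent (f x) :=
  'd (cmap (chart_at (f x)) \o f \o cinv (chart_at x)) (cmap (chart_at x) x).
Arguments tangent_map {R M N} f x _.

Definition tangent_map_vec (R : realType) (M : manifoldType R)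
    (V : normedModType R) (f : M -> V) (x : M) : tangent x -> V :=
  'd (f \o cinv (chart_at x)) (cmap (chart_at x) x).
Arguments tangent_map_vec {R M V} f x _.

(* Velocity at time 0 of a curve c with c 0 = x. *)
Definition velocity (R : realType) (M : manifoldType R) (x : M) (c : R -> M) :
    tangent x :=
  derive1 (cmap (chart_at x) \o c) 0.

Notation lieAlg G := (tangent (1%g : G)).

Definition Ad (R : realType) (G : lieGroupType R) (g : G) :
    lieAlg G -> lieAlg G :=
  tangent_map (fun x : G => (g * x * g^-1)%g) 1%g.

Definition lie_hom (R : realType) (G' G : lieGroupType R) (h : G' -> G) :=
  (forall k, Ck_map k (atlas G') (atlas G) h) /\
  forall x y : G', h (x * y)%g = (h x * h y)%g.

(* ip is a scalar product on the linear subspace S of V. *)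
Definition scalar_product (R : realType) (V : lmodType R) (S : set V)
    (ip : V -> V -> R) :=
  [/\ forall u v, S u -> S v -> ip u v = ip v u,
      forall a u v w, S u -> S v -> S w ->
        ip (a *: u + v) w = a * ip u w + ip v w &
      forall u, S u -> u != 0 -> 0 < ip u u].

Definition ip_norm (R : realType) (V : Type) (ip : V -> V -> R) (v : V) : R :=
  Num.sqrt (ip v v).

(* M_d(C) as a real normed space: real part and imaginary part *)
Notation cmat R d := ('M[R]_d * 'M[R]_d)%type.

Definition to_cmat (R : realType) (d : nat) (A : 'M[R[i]]_d) : cmat R d :=
  (map_mx (@complex.Re R) A, map_mx (@complex.Im R) A).

Definition of_cmat (R : realType) (d : nat) (Z : cmat R d) : 'M[R[i]]_d :=
  \matrix_(i, j) Complex (Z.1 i j) (Z.2 i j).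

Definition Ad_mx (R : realType) (d : nat) (A : 'M[R[i]]_d) (Z : cmat R d) :
    cmat R d :=
  to_cmat (A *m of_cmat Z *m invmx A).

Definition cvec_norm (R : realType) (d : nat) (v : 'cV[R[i]]_d) : R :=
  Num.sqrt (\sum_i (complex.Re (v i 0) ^+ 2 + complex.Im (v i 0) ^+ 2)).

Definition op_norm (R : realType) (d : nat) (Z : cmat R d) : R :=
  sup [set cvec_norm (of_cmat Z *m v) | v in [set v | cvec_norm v <= 1]].

(* Representations of a Lie group are smooth. The columns of W^T span the
   subspace of C^d whose invariance is tested in the last clause. *)
Definition unitary_irrep (R : realType) (G : lieGroupType R) (d : nat)
    (pi : G -> 'M[R[i]]_d) :=
  [/\ (0 < d)%N,
      forall g, pi g \is unitarymx,
      forall x y, pi (x * y)%g = pi x *m pi y,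
      forall k, Ck_map k (atlas G) (vec_atlas (cmat R d))
        (fun g => to_cmat (pi g)) &
      forall W : 'M[R[i]]_d, (forall g, stablemx W (pi g)^T) ->
        \rank W = 0%N \/ \rank W = d].

(* Lie algebra of a closed subgroup H of GL_d(C): its tangent space at 1 *)
Definition mx_lieAlg (R : realType) (d : nat) (H : set 'M[R[i]]_d) :
    set (cmat R d) :=
  [set Z | exists c : R -> 'M[R[i]]_d,
     [/\ c 0 = 1%:M, forall t, H (c t), Ck 1 setT (fun t => to_cmat (c t)) &
         Z = derive1 (fun t => to_cmat (c t)) 0]].

Notation borel T := (g_sigma_algebraType (@open T)).

Definition C1_flow (R : realType) (X : manifoldType R) (F : R -> X -> X) :=
  [/\ forall x, F 0 x = x,
      forall s t x, F (s + t) x = F s (F t x) &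
      Ck_map 1 (prod_atlas (vec_atlas R) (atlas X)) (atlas X)
        (fun p : R * X => F p.1 p.2)].

Definition flow_preserves (R : realType) (X : manifoldType R)
    (mu : probability (borel X) R) (F : R -> X -> X) :=
  forall (t : R) (A : set (borel X)), measurable A -> mu (F t @^-1` A) = mu A.

Section degree.
Variables (R : realType) (X : manifoldType R) (mu : probability (borel X) R).
Variable F : R -> X -> X.

Section projection.
(* The Lie algebra is the subspace S of V, with scalar product ip; U x is the
   linear operator of S through which W acts in the fibre over x. *)
Variables (V : normedModType R) (S : set V) (ip : V -> V -> R).
Variable U : X -> V -> V.

Definition L2 (f : X -> V) :=
  [/\ forall x, S (f x), measurable_fun setT (f : borel X -> borel V) &
      (\int[mu]_x (ip (f x) (f x))%:E < +oo)%E].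

Definition L2dot (f1 f2 : X -> V) : R := \int[mu]_x ip (f1 x) (f2 x).

Definition W_op (f : X -> V) : X -> V := fun x => U x (f (F 1 x)).

Definition in_ker_1W (f : X -> V) :=
  L2 f /\ {ae mu, forall x, W_op f x = f x}.

Definition is_ker_proj (f p : X -> V) :=
  in_ker_1W p /\ forall q, in_ker_1W q -> L2dot (f \- p) q = 0.

(* A representative of the class of P f in L^2; it exists, and is unique
   almost everywhere, for f in L^2. *)
Definition ker_proj (f : X -> V) : X -> V := xget (cst 0) (is_ker_proj f).

End projection.

Section lie_group.
Variables (G : lieGroupType R) (ip : lieAlg G -> lieAlg G -> R).

Definition lie_deriv (phi : X -> G) (x : X) : tangent (phi x) :=
  velocity (phi x) (fun t => phi (F t x)).

Definition M_fun (phi : X -> G) (x : X) : lieAlg G :=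
  tangent_map (fun g : G => (g * (phi x)^-1)%g) (phi x) (lie_deriv phi x).

Definition degree (phi : X -> G) : X -> lieAlg G :=
  ker_proj setT ip (fun x => Ad (phi x)) (M_fun phi).

End lie_group.

Section matrix_group.
Variables (d : nat) (S : set (cmat R d)) (ip : cmat R d -> cmat R d -> R).

Definition lie_deriv_mx (a : X -> 'M[R[i]]_d) (x : X) : cmat R d :=
  derive1 (fun t => to_cmat (a (F t x))) 0.

Definition M_mx (a : X -> 'M[R[i]]_d) (x : X) : cmat R d :=
  to_cmat (of_cmat (lie_deriv_mx a x) *m invmx (a x)).

Definition degree_mx (a : X -> 'M[R[i]]_d) : X -> cmat R d :=
  ker_proj S ip (fun x => Ad_mx (a x)) (M_mx a).

End matrix_group.

End degree.

(* Main.v *)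
Require Import Defs.
From HB Require Import structures.
From mathcomp Require Import all_boot all_order all_algebra.
From mathcomp Require Import all_classical all_reals all_analysis.
From mathcomp Require Import complex measurable_realfun ring lra.
Set Implicit Arguments.
Unset Strict Implicit.
Unset Printing Implicit Defensive.
Import Order.TTheory GRing.Theory Num.Theory.
Import numFieldNormedType.Exports.
Local Open Scope classical_set_scope.
Local Open Scope ring_scope.

(** Why the statement is true.

    Hilbert space part.  The degree is the orthogonal projection of M_phi onto
    the W_phi-invariant functions, and two mechanisms transport such
    projections.

    Parts (a) and (c): let T be a linear map between the Lie algebras which
    intertwines the two adjoint actions.  Applied pointwise, T sends invariant
    functions to invariant functions.  As both scalar products are
    Ad-invariant, the adjoint T* also intertwines the actions, so it sends
    invariant functions back to invariant functions.  Hence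
    <T f - T p, q> = <f - p, T* q> = 0 for every invariant q as soon as p is
    the projection of f: T p is the projection of T f, even though T need not
    be isometric ([ker_proj_hom]).  This is used with T = dh and T = d pi,
    because M_(h o delta) = dh (M_delta) and dh Ad_g = Ad_(h g) dh ([M_hom],
    [hom_Ad], [M_mx_rep], [rep_Ad_mx]).  Part (c) is the case T = d pi followed
    by (a).

    Parts (b) and (d): phi = zeta^-1 delta (zeta o F_1) yields the cocycle
    relation M_delta = Ad_zeta M_phi + (1 - W_delta) M_zeta ([M_cocycle]).  The
    last term is orthogonal to the kernel of 1 - W_delta because W_delta is
    isometric ([dot_W_ker]), and Ad_zeta is an isometry which conjugates W_phi
    to W_delta ([ker_proj_intertwine]).  Part (d) follows from (b) by applying
    d pi; conjugation by a unitary matrix preserves the operator norm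
    ([op_norm_Ad_mx]).

    The projection must also be shown to exist ([ker_projP]): a sequence of
    invariant functions minimizing the distance to f is Cauchy by the
    parallelogram identity; if it is chosen to converge fast, it converges
    almost everywhere, the limit is invariant because F_1 preserves null sets,
    and it realizes the distance by Fatou's lemma.

    Differential geometry part.  Tangent maps are given by derivatives in
    charts that are chosen pointwise.  All identities between them are obtained
    by following velocities of curves ([has_velocity]), which behave well under
    maps, products and changes of chart; for instance M_phi (x) is the velocity
    at the identity of t |-> phi (F_t x) phi (x)^-1 ([M_velocity]).  Analysis in
    coordinates is only needed to see that M_phi and g |-> Ad_g v are
    continuous ([continuous_M], [continuous_Ad]): this makes them measurable,
    and M_phi bounded on the compact manifold X, hence square integrable. *)

(** * Linear functions and row vectors *)

Section unbundled_linear_functions.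
Context {R : comNzRingType} (V W : lmodType R) (L : V -> W).
Hypothesis Llin : linear L.

Let linL : {linear V -> W} :=
  HB.pack L (GRing.isLinear.Build _ _ _ _ _ Llin).

Lemma linear_fun0 : L 0 = 0.
Proof. exact: (raddf0 linL). Qed.

Lemma linear_funB u v : L (u - v) = L u - L v.
Proof. exact: (raddfB linL). Qed.

End unbundled_linear_functions.

Lemma linear_fun_rV (R : comNzRingType) (W : lmodType R) n (L : 'rV[R]_n -> W)
    (u : 'rV[R]_n) :
  linear L -> L u = \sum_i u 0 i *: L (delta_mx 0 i).
Proof.
move=> Llin.
pose L' : {linear 'rV[R]_n -> W} :=
  HB.pack L (GRing.isLinear.Build _ _ _ _ _ Llin).
rewrite -[L]/(L' : _ -> _) {1}(row_sum_delta u) linear_sum.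
by apply: eq_bigr => i _; rewrite linearZ.
Qed.

(** * Charts, and velocities of curves in charts *)

Section curves.
Context {R : realType}.

(** The first two clauses are what allows the velocity to be read in any other
    chart around [c 0], or to be pushed forward by a map that is differentiable
    in charts. *)
Definition has_velocity (E : normedModType R) (T : topologicalType) (a : chart E T)
    (c : R -> T) (v : E) :=
  [/\ cdom a (c 0), {for 0, continuous c} &
      is_derive (0 : R) 1 (cmap a \o c) v].

(** Differentiability at a single point: unlike [Ck_map], it is stable under
    composition by the chain rule alone. *)
Definition chart_diff (E E' : normedModType R) (T T' : topologicalType)
    (a : chart E T) (b : chart E' T') (f : T -> T') (p : T) :=
  [/\ cdom b (f p), {for p, continuous f} &
      differentiable (cmap b \o f \o cinv a) (cmap a p)].

Definition prod_chart (E E' : normedModType R) (T T' : topologicalType)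
    (a : chart E T) (b : chart E' T') : chart (E * E')%type (T * T')%type :=
  Chart (cdom a `*` cdom b) (fun p => (cmap a p.1, cmap b p.2))
        (fun q => (cinv a q.1, cinv b q.2)).

Definition id_chart (E : normedModType R) : chart E E := Chart setT id id.

Lemma is_chart_id (E : normedModType R) : is_chart (id_chart E).
Proof.
split => //=.
- exact: openT.
- by rewrite image_id; exact: openT.
- by move=> x _; exact: cvg_id.
- by move=> x _; exact: cvg_id.
Qed.

Lemma continuous_pair (S T T' : topologicalType) (f : S -> T) (g : S -> T') s :
  {for s, continuous f} -> {for s, continuous g} ->
  {for s, continuous (fun x => (f x, g x))}.
Proof. by move=> cf cg; exact: (cvg_pair cf cg). Qed.

Lemma open_setX (S T : topologicalType) (A : set S) (B : set T) :
  open A -> open B -> open (A `*` B).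
Proof.
move=> oA oB; rewrite (_ : A `*` B = fst @^-1` A `&` snd @^-1` B) //.
by apply: openI; apply: open_comp => // x _; [exact: cvg_fst|exact: cvg_snd].
Qed.

Lemma is_chart_prod (E E' : normedModType R) (T T' : topologicalType)
    (a : chart E T) (b : chart E' T') :
  is_chart a -> is_chart b -> is_chart (prod_chart a b).
Proof.
move=> [oa oia ia ca cia] [ob oib ib cb cib].
have im : cmap (prod_chart a b) @` cdom (prod_chart a b) =
    (cmap a @` cdom a) `*` (cmap b @` cdom b).
  apply/seteqP; split => [_ [p [p1 p2] <-]|[y z] [[p1 p1a p1y] [p2 p2b p2z]]] /=.
    by split; [exists p.1|exists p.2].
  by exists (p1, p2) => //=; move: p1y p2z => /= -> ->.
split.
- exact: open_setX.
- by rewrite im; exact: open_setX.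
- by move=> [x y] [/= xa yb]; rewrite ia // ib.
- move=> [x y] [/= xa yb]; apply: continuous_pair.
    by apply: (@continuous_comp _ _ _ fst) => /=; [exact: cvg_fst|exact: ca].
  by apply: (@continuous_comp _ _ _ snd) => /=; [exact: cvg_snd|exact: cb].
- rewrite im => -[x y] [/= xa yb]; apply: continuous_pair.
    by apply: (@continuous_comp _ _ _ fst) => /=; [exact: cvg_fst|exact: cia].
  by apply: (@continuous_comp _ _ _ snd) => /=; [exact: cvg_snd|exact: cib].
Qed.

Lemma is_derive_diff (E E' : normedModType R) (f : E -> E') (c : R -> E)
    (t : R) (v : E) :
  differentiable f (c t) -> is_derive t 1 c v ->
  is_derive t 1 (f \o c) ('d f (c t) v).
Proof.
move=> df [/derivable1_diffP dc cv].
apply: DeriveDef; first exact/derivable1_diffP/differentiable_comp.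
rewrite deriveE; last exact: differentiable_comp.
by rewrite diff_comp //= -cv deriveE.
Qed.

Lemma is_derive_scalel (E : normedModType R) (c : R -> R) (t c' : R) (v : E) :
  is_derive t 1 c c' -> is_derive t 1 (fun s => c s *: v) (c' *: v).
Proof.
move=> dc.
have dl : is_diff (c t) ( *:%R ^~ v) ( *:%R ^~ v) by exact: is_diff_scalel.
have df : differentiable (fun s : R => s *: v) (c t) by exact: ex_diff.
have := is_derive_diff df dc.
by rewrite diff_val.
Qed.

(** The chain rule; it applies because c stays in the domain of a near 0, so
    that [cinv a] undoes [cmap a] along c. *)
Lemma velocity_push (E E' : normedModType R) (T T' : topologicalType)
    (a : chart E T) (b : chart E' T') (f : T -> T') (c : R -> T) p v :
  is_chart a -> chart_diff a b f p -> c 0 = p -> has_velocity a c v ->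
  has_velocity b (f \o c) ('d (cmap b \o f \o cinv a) (cmap a p) v).
Proof.
move=> [oa _ ia _ _] [bf cf df] c0; subst p => -[ac0 cc dc]; split => //.
  exact: continuous_comp.
apply: (@near_eq_is_derive _ _ _ ((cmap b \o f \o cinv a) \o (cmap a \o c))).
  have : \forall t \near (0 : R), cdom a (c t).
    by apply: cc; apply: open_nbhs_nbhs.
  by apply: filterS => t act /=; rewrite ia.
exact: is_derive_diff.
Qed.

Lemma velocity_unique (E : normedModType R) (T : topologicalType)
    (a : chart E T) (c : R -> T) v w : has_velocity a c v -> has_velocity a c w -> v = w.
Proof. by move=> [_ _ [_ <-]] [_ _ [_ <-]]. Qed.

Lemma velocity_cst (E : normedModType R) (T : topologicalType) (a : chart E T) x :
  cdom a x -> has_velocity a (cst x) 0.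
Proof.
move=> ax; split => //; first exact: cst_continuous.
exact: (is_derive_cst (cmap a x) (0 : R) (1 : R)).
Qed.

Lemma is_derive_pair (E E' : normedModType R) (c : R -> E) (d : R -> E') v w :
  is_derive (0 : R) 1 c v -> is_derive (0 : R) 1 d w ->
  is_derive (0 : R) 1 (fun t => (c t, d t)) (v, w).
Proof.
move=> [/derivable1_diffP dc cv] [/derivable1_diffP dd dw].
apply: DeriveDef; first exact/derivable1_diffP/differentiable_pair.
rewrite deriveE; last exact: differentiable_pair.
by rewrite diff_pair // -cv -dw !deriveE.
Qed.

Lemma velocity_pair (E E' : normedModType R) (T T' : topologicalType)
    (a : chart E T) (b : chart E' T') c d v w :
  has_velocity a c v -> has_velocity b d w ->
  has_velocity (prod_chart a b) (fun t => (c t, d t)) (v, w).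
Proof.
move=> [ac cc dc] [bd cd dd]; split => //; first exact: continuous_pair.
exact: (is_derive_pair dc dd).
Qed.

(** The curve is a straight line in the chart; thanks to it, an identity between
    tangent maps can be tested on velocities. *)
Lemma velocity_exists (E : normedModType R) (T : topologicalType) (a : chart E T)
    x v : is_chart a -> cdom a x -> exists2 c, c 0 = x & has_velocity a c v.
Proof.
move=> [oa oia ia ca cia] ax.
exists (fun t => cinv a (cmap a x + t *: v)).
  by rewrite scale0r addr0 ia.
have cl : {for 0, continuous (fun t : R => cmap a x + t *: v)}.
  by apply: cvgD; [exact: cvg_cst|exact: scalel_continuous].
split; first by rewrite scale0r addr0 ia.
  apply: (@continuous_comp _ _ _ (fun t : R => cmap a x + t *: v)) => //.
  by apply: cia; rewrite scale0r addr0; exists x.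
have : \forall t \near (0:R), (cmap a @` cdom a) (cmap a x + t *: v).
  apply: cl; rewrite scale0r addr0; apply: open_nbhs_nbhs.
  by split; [exact: oia|exact: imageP].
move=> nr.
apply: (@near_eq_is_derive _ _ _ (fun t : R => cmap a x + t *: v)).
  by move: nr; apply: filterS => t [y ay yt] /=; rewrite -yt ia.
have dv := is_derive_scalel v (is_derive_id (0 : R) 1).
rewrite scale1r in dv.
rewrite -[X in is_derive _ _ _ X]add0r.
exact: (is_deriveD (is_derive_cst (cmap a x) (0 : R) (1 : R)) dv).
Qed.

Lemma near_eq_differentiable (E E' : normedModType R) (f g : E -> E') x :
  (\forall y \near x, f y = g y) -> differentiable f x -> differentiable g x.
Proof.
move=> fg df.
have key : g \o shift x = cst (g x) + 'd f x +o_ 0 id.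
  apply/eqaddoP => e e0.
  have /eqaddoP/(_ _ e0) := diff_locally df.
  have : \forall h \near (0:E), f (h + x) = g (h + x).
    have sc : {for 0, continuous (fun h : E => h + x)}.
      by apply: cvgD; [exact: cvg_id|exact: cvg_cst].
    have fg0 : \forall y \near (0 + x), f y = g y by rewrite add0r.
    exact: (sc _ fg0).
  apply: filterS2 => h; rewrite !fctE /= => ->.
  by rewrite (nbhs_singleton fg).
have dfc := diff_continuous df.
apply/diff_locallyP; split; rewrite (diff_unique dfc key) //.
Qed.

(** Around p, the intermediate chart cancels: [cinv b] undoes [cmap b]. *)
Lemma chart_diff_comp (E1 E2 E3 : normedModType R) (T1 T2 T3 : topologicalType)
    (a : chart E1 T1) (b : chart E2 T2) (c : chart E3 T3)
    (f : T1 -> T2) (g : T2 -> T3) p :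
  is_chart a -> is_chart b -> cdom a p -> chart_diff a b f p -> chart_diff b c g (f p) ->
  chart_diff a c (g \o f) p.
Proof.
move=> [oa oia ia ca cia] [ob oib ib cb cib] ap [bf cf df] [cg cg' dg].
split => //; first exact: continuous_comp.
apply: (@near_eq_differentiable _ _
  ((cmap c \o g \o cinv b) \o (cmap b \o f \o cinv a))).
  have cc : {for cmap a p, continuous (f \o cinv a)}.
    apply: continuous_comp; first by apply: cia; exists p.
    by rewrite ia.
  have : \forall y \near cmap a p, cdom b (f (cinv a y)).
    by apply: cc; apply: open_nbhs_nbhs; split => //=; rewrite ia.
  by apply: filterS => y /= by_; rewrite ib.
by apply: differentiable_comp => //=; rewrite ia.
Qed.

Lemma Ck_chart_diff (E E' : normedModType R) (T T' : topologicalType) k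
    (A : set (chart E T)) (A' : set (chart E' T')) (f : T -> T') a b p :
  Ck_map k.+1 A A' f -> A a -> A' b -> is_chart a -> cdom a p -> cdom b (f p) ->
  chart_diff a b f p.
Proof.
move=> [cf /(_ a b) + ] Aa Ab ca ap bf => /(_ Aa Ab)[df _].
by split => //; [exact: cf|apply: df; exists p].
Qed.

(** Partial maps are compositions with the slices x |-> (x, q) and
    y |-> (p, y), which read as affine maps in charts. *)
Lemma chart_diff_partial (E1 E2 E3 : normedModType R) (T1 T2 T3 : topologicalType)
    (a : chart E1 T1) (b : chart E2 T2) (c : chart E3 T3)
    (f : T1 * T2 -> T3) p q :
  is_chart a -> is_chart b -> cdom a p -> cdom b q ->
  chart_diff (prod_chart a b) c f (p, q) ->
  chart_diff a c (fun x => f (x, q)) p /\ chart_diff b c (fun y => f (p, y)) q.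
Proof.
move=> cha chb ap bq mf.
have dx (E F : normedModType R) (d : F) (x : E) :
    differentiable (fun u : E => (u, d)) x.
  by apply: differentiable_pair; [exact: ex_diff|exact: differentiable_cst].
have dy (E F : normedModType R) (d : F) (x : E) :
    differentiable (fun u : E => (d, u)) x.
  by apply: differentiable_pair; [exact: differentiable_cst|exact: ex_diff].
have ia : cinv a (cmap a p) = p by case: cha => _ _ + _ _; apply.
have ib : cinv b (cmap b q) = q by case: chb => _ _ + _ _; apply.
have cpr := is_chart_prod cha chb.
split; apply: (@chart_diff_comp _ _ _ _ _ _ _ (prod_chart a b)) => //.
- split => //=; first by apply: continuous_pair; [exact: cvg_id|exact: cvg_cst].
  rewrite (_ : _ \o _ = (fun u => (cmap a (cinv a u), cmap b q))) //.
  apply: (@near_eq_differentiable _ _ (fun u => (u, cmap b q))) => //.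
  have : \forall u \near cmap a p, (cmap a @` cdom a) u.
    by case: cha => _ oia _ _ _; apply: open_nbhs_nbhs; split => //; exists p.
  apply: filterS => _ [x ax <-] /=.
  by case: cha => _ _ ia' _ _; rewrite ia'.
- split => //=; first by apply: continuous_pair; [exact: cvg_cst|exact: cvg_id].
  rewrite (_ : _ \o _ = (fun u => (cmap a p, cmap b (cinv b u)))) //.
  apply: (@near_eq_differentiable _ _ (fun u => (cmap a p, u))) => //.
  have : \forall u \near cmap b q, (cmap b @` cdom b) u.
    by case: chb => _ oib _ _ _; apply: open_nbhs_nbhs; split => //; exists q.
  apply: filterS => _ [x bx <-] /=.
  by case: chb => _ _ ib' _ _; rewrite ib'.
Qed.

End curves.

(** * Continuous dependence of a derivative on its base point *)

Section continuity_of_derivatives.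
Context {R : realType}.

(** In finite dimension, d f (g y) (w y) is the sum of the coordinates of w y
    times directional derivatives of f at g y, and these are continuous by
    definition of C^1.  The embedding iota lets the direction vary in a finite
    dimensional factor of V only. *)
Lemma continuous_diff_apply (T : topologicalType) (V W : normedModType R) n
    (iota : {linear 'rV[R]_n -> V}) (U : set V) (f : V -> W) (g : T -> V)
    (w : T -> 'rV[R]_n) x :
  Ck 1 U f -> {for x, continuous g} -> {for x, continuous w} ->
  (\forall y \near x, U (g y)) ->
  {for x, continuous (fun y => 'd f (g y) (iota (w y)))}.
Proof.
move=> [df cf] cg cw nU.
have Ugx := nbhs_singleton nU.
pose S y := \sum_i w y 0 i *: 'D_(iota (delta_mx 0 i)) f (g y).
have eqS y : U (g y) -> 'd f (g y) (iota (w y)) = S y.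
  move=> Uy; rewrite {1}(row_sum_delta (w y)) linear_sum linear_sum.
  by apply: eq_bigr => i _; rewrite !linearZ /= deriveE //; exact: df.
have cS : S @ x --> S x.
  rewrite /S; apply: cvg_big => [|i _]; first exact: add_continuous.
  apply: cvgZ.
    apply: (@continuous_comp _ _ _ w (fun v : 'rV[R]_n => v 0 i)) => //.
    exact: coord_continuous.
  exact: (@continuous_comp _ _ _ g (fun y => 'D_(iota (delta_mx 0 i)) f y)
    x cg (cf _ _ Ugx)).
rewrite /prop_for /continuous_at /= eqS //.
apply: cvg_trans cS; apply: near_eq_cvg.
by apply: filterS nU => y /eqS.
Qed.

Lemma continuous_diff_applyl (T : topologicalType) n (V W : normedModType R)
    (U : set ('rV[R]_n * V)%type) (f : 'rV[R]_n * V -> W)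
    (g : T -> 'rV[R]_n * V) (w : T -> 'rV[R]_n) x :
  Ck 1 U f -> {for x, continuous g} -> {for x, continuous w} ->
  (\forall y \near x, U (g y)) ->
  {for x, continuous (fun y => 'd f (g y) (w y, 0))}.
Proof.
have lin0 : linear (fun v : 'rV[R]_n => (v, 0) : 'rV[R]_n * V).
  by move=> k u v; congr pair; rewrite /= ?scaler0 ?addr0.
pose i0 : {linear 'rV[R]_n -> ('rV[R]_n * V)%type} :=
  HB.pack (fun v : 'rV[R]_n => (v, 0) : 'rV[R]_n * V)
    (GRing.isLinear.Build _ _ _ _ _ lin0).
exact: (@continuous_diff_apply _ _ _ n i0).
Qed.

Lemma continuous_derive_comp (T : topologicalType) (V W : normedModType R)
    (U : set V) (f : V -> W) (g : T -> V) v x :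
  Ck 1 U f -> {for x, continuous g} -> (\forall y \near x, U (g y)) ->
  {for x, continuous (fun y => 'd f (g y) v)}.
Proof.
move=> [df cf] cg nU; have Ugx := nbhs_singleton nU.
rewrite /prop_for /continuous_at /=.
have cS : 'D_v f (g y) @[y --> x] --> 'D_v f (g x).
  exact: (@continuous_comp _ _ _ g (fun y => 'D_v f y) x cg (cf _ _ Ugx)).
rewrite -deriveE; last exact: df.
apply: cvg_trans cS; apply: near_eq_cvg.
by apply: filterS nU => y Uy; rewrite deriveE //; exact: df.
Qed.

End continuity_of_derivatives.

(** * Manifolds and Lie groups *)

Section manifolds.
Context {R : realType}.

Lemma chart_atP (M : manifoldType R) (x : M) :
  atlas M (chart_at x) /\ cdom (chart_at x) x.
Proof. by rewrite /chart_at; case: cid. Qed.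

Lemma atlas_at (M : manifoldType R) (x : M) : atlas M (chart_at x).
Proof. by have [] := chart_atP x. Qed.
Hint Resolve atlas_at : core.

Lemma atlas_is_chart (M : manifoldType R) a : atlas M a -> is_chart a.
Proof. by case: (@atlas_smooth R M) => + _ _; apply. Qed.

Lemma chart_at_chart (M : manifoldType R) (x : M) : is_chart (chart_at x).
Proof. exact: atlas_is_chart. Qed.
Hint Resolve chart_at_chart : core.

Lemma chart_at_dom (M : manifoldType R) (x : M) : cdom (chart_at x) x.
Proof. by have [] := chart_atP x. Qed.
Hint Resolve chart_at_dom : core.

Lemma velocityE (M : manifoldType R) (x : M) c v :
  has_velocity (chart_at x) c v -> velocity x c = v.
Proof. by move=> [_ _ [_ <-]]; rewrite /velocity derive1E. Qed.

Lemma tangent_map_velocity (M N : manifoldType R) (f : M -> N) p c v :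
  chart_diff (chart_at p) (chart_at (f p)) f p -> c 0 = p ->
  has_velocity (chart_at p) c v ->
  has_velocity (chart_at (f p)) (f \o c) (tangent_map f p v).
Proof. by move=> mf c0 cv; apply: velocity_push. Qed.

Lemma Ck_chart_diff_at (M N : manifoldType R) k (f : M -> N) p :
  Ck_map k.+1 (atlas M) (atlas N) f -> chart_diff (chart_at p) (chart_at (f p)) f p.
Proof.
by move=> fk; exact: (Ck_chart_diff fk).
Qed.

End manifolds.
#[local] Hint Resolve chart_at_chart : core.
#[local] Hint Resolve chart_at_dom : core.
#[local] Hint Resolve atlas_at : core.

Section lie.
Context {R : realType} (G : lieGroupType R).

Local Notation e := (chart_at (1%g : G)).

Lemma mul_chart_diff (a b c : chart 'rV[R]_(mdim G) G) (p q : G) :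
  atlas G a -> atlas G b -> atlas G c -> cdom a p -> cdom b q ->
  cdom c (p * q)%g ->
  chart_diff (prod_chart a b) c (fun z : G * G => (z.1 * z.2)%g) (p, q).
Proof.
move=> Aa Ab Ac ap bq cpq; apply: (Ck_chart_diff (lie_mul_smooth 1)) => //.
  by exists a, b.
exact: (is_chart_prod (atlas_is_chart Aa) (atlas_is_chart Ab)).
Qed.

Lemma mul_C1 (a b c : chart 'rV[R]_(mdim G) G) :
  atlas G a -> atlas G b -> atlas G c ->
  let mul := fun z : G * G => (z.1 * z.2)%g in
  Ck 1 (cmap (prod_chart a b) @` (cdom (prod_chart a b) `&` mul @^-1` cdom c))
    (cmap c \o mul \o cinv (prod_chart a b)).
Proof.
move=> Aa Ab Ac mul; have [_ /(_ (prod_chart a b) c)] := @lie_mul_smooth R G 1.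
by apply => //; exists a, b.
Qed.

Lemma mulr_chart_diff (a c : chart 'rV[R]_(mdim G) G) (p q : G) :
  atlas G a -> atlas G c -> cdom a p -> cdom c (p * q)%g ->
  chart_diff a c (fun x : G => (x * q)%g) p.
Proof.
move=> Aa Ac ap cpq.
have Aq := atlas_at q; have bq := chart_at_dom q.
have := mul_chart_diff Aa Aq Ac ap bq cpq.
by case/(chart_diff_partial (atlas_is_chart Aa) (atlas_is_chart Aq) ap bq).
Qed.

Lemma mull_chart_diff (a c : chart 'rV[R]_(mdim G) G) (p q : G) :
  atlas G a -> atlas G c -> cdom a p -> cdom c (q * p)%g ->
  chart_diff a c (fun x : G => (q * x)%g) p.
Proof.
move=> Aa Ac ap cpq.
have Aq := atlas_at q; have bq := chart_at_dom q.
have := mul_chart_diff Aq Aa Ac bq ap cpq.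
by case/(chart_diff_partial (atlas_is_chart Aq) (atlas_is_chart Aa) bq ap).
Qed.

Lemma conj_chart_diff (g : G) : chart_diff e e (fun x : G => (g * x * g^-1)%g) 1%g.
Proof.
apply: (@chart_diff_comp _ _ _ _ _ _ _ e (chart_at g) e (fun x : G => (g * x)%g)
         (fun x : G => (x * g^-1)%g)) => //.
  by apply: mull_chart_diff => //; rewrite mulg1.
by apply: mulr_chart_diff => //; rewrite mulg1 // mulgV.
Qed.

(** Every identity satisfied by Ad is read off from this description. *)
Lemma Ad_velocity (g : G) c v : c 0 = 1%g -> has_velocity e c v ->
  has_velocity e (fun t => (g * c t * g^-1)%g) (Ad g v).
Proof.
move=> c0 cv.
have g1 : (g * 1 * g^-1)%g = 1%g by rewrite mulg1 mulgV.
have := @tangent_map_velocity R G G (fun x : G => (g * x * g^-1)%g) 1%g c v _ c0 cv.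
by rewrite /Ad /= g1; apply; exact: conj_chart_diff.
Qed.

Lemma lieAlg_curve (v : lieAlg G) : exists2 c : R -> G, c 0 = 1%g & has_velocity e c v.
Proof. exact: velocity_exists. Qed.

Lemma AdM (g h : G) v : Ad (g * h)%g v = Ad g (Ad h v).
Proof.
have [c c0 cv] := lieAlg_curve v.
have h1 := Ad_velocity (g * h)%g c0 cv.
have c10 : (h * c 0 * h^-1)%g = 1%g by rewrite c0 mulg1 mulgV.
have h2 := Ad_velocity g c10 (Ad_velocity h c0 cv).
apply: (velocity_unique h1); move: h2; congr (has_velocity e _ _).
by rewrite funeqE => t; rewrite invgM !mulgA.
Qed.

Lemma Ad1 v : Ad (1%g : G) v = v.
Proof.
have [c c0 cv] := lieAlg_curve v.
have h1 := Ad_velocity 1%g c0 cv.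
apply: (velocity_unique h1).
by rewrite (_ : (fun t => _) = c) // funeqE => t; rewrite invg1 mulg1 mul1g.
Qed.

(** The differential of the multiplication at (1, 1) is (v, w) |-> v + w: by
    linearity it suffices to know it on (v, 0) and (0, w), where one of the two
    curves is constant. *)
Lemma mul_velocity (c d : R -> G) v w : c 0 = 1%g -> d 0 = 1%g ->
  has_velocity e c v -> has_velocity e d w ->
  has_velocity e (fun t => (c t * d t)%g) (v + w).
Proof.
move=> c0 d0 cv dw.
have md : chart_diff (prod_chart e e) e (fun z : G * G => (z.1 * z.2)%g) (1%g, 1%g).
  by apply: mul_chart_diff => //; rewrite mulg1.
have cp : is_chart (prod_chart e e) by exact: is_chart_prod.
pose D := 'd (cmap e \o (fun z : G * G => (z.1 * z.2)%g) \o cinv (prod_chart e e))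
    (cmap (prod_chart e e) ((1, 1)%g : G * G)).
have push (a b : R -> G) u u' : a 0 = 1%g -> b 0 = 1%g -> has_velocity e a u ->
    has_velocity e b u' -> has_velocity e (fun t => (a t * b t)%g) (D (u, u')).
  move=> a0 b0 au bu.
  apply: (@velocity_push R _ _ _ _ (prod_chart e e) e (fun z : G * G => (z.1 * z.2)%g)
    (fun t => (a t, b t)) (1, 1)%g (u, u')) => //; first by rewrite a0 b0.
  exact: velocity_pair.
have c1 : has_velocity e (cst (1%g : G)) 0 by exact: velocity_cst.
have -> : v + w = D (v, w).
  have -> : (v, w) = (v, 0) + (0, w) :> 'rV[R]_(mdim G) * 'rV[R]_(mdim G).
    by congr pair; rewrite ?addr0 ?add0r.
  rewrite linearD; congr (_ + _).
    apply: (velocity_unique cv); rewrite (_ : c = (fun t => (c t * cst 1 t)%g)).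
      exact: (push c (cst 1%g) v 0 c0 erefl cv c1).
    by rewrite funeqE => t; rewrite mulg1.
  apply: (velocity_unique dw); rewrite (_ : d = (fun t => (cst 1 t * d t)%g)).
    exact: (push (cst 1%g) d 0 w erefl d0 c1 dw).
  by rewrite funeqE => t; rewrite mul1g.
exact: push.
Qed.

End lie.

(** * The logarithmic derivative M along the flow *)

Section flow.
Context {R : realType} (X : manifoldType R) (F : R -> X -> X).
Hypothesis F_flow : C1_flow F.

Let F0 x : F 0 x = x. Proof. by case: F_flow. Qed.

Lemma flow_chart_diff (a b : chart 'rV[R]_(mdim X) X) t x :
  atlas X a -> atlas X b -> cdom a x -> cdom b (F t x) ->
  chart_diff (prod_chart (id_chart R) a) b (fun p : R * X => F p.1 p.2) (t, x).
Proof.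
move=> Aa Ab ax bFx; have [_ _ FC] := F_flow.
apply: (Ck_chart_diff FC) => //; first by exists (id_chart R), a.
by apply: is_chart_prod; [exact: is_chart_id|exact: atlas_is_chart].
Qed.

(** The vector field of the flow at x, read in the chart b, through the
    coordinates of x in the chart a; with a fixed, the formula depends
    continuously on x. *)
Lemma flow_velocity (a b : chart 'rV[R]_(mdim X) X) x :
  atlas X a -> atlas X b -> cdom a x -> cdom b x ->
  has_velocity b (fun t => F t x)
    ('d (cmap b \o (fun p : R * X => F p.1 p.2) \o cinv (prod_chart (id_chart R) a))
       (0, cmap a x) (1, 0)).
Proof.
move=> Aa Ab ax bx.
apply: (@velocity_push R _ _ _ _ (prod_chart (id_chart R) a) b
   (fun p : R * X => F p.1 p.2) (fun t => (t, x)) (0, x)) => //.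
- by apply: is_chart_prod; [exact: is_chart_id|exact: atlas_is_chart].
- by apply: flow_chart_diff; rewrite ?F0.
- apply: (@velocity_pair _ _ _ _ _ (id_chart R) a id (cst x)); last exact: velocity_cst.
  split; [by []|exact: cvg_id|exact: is_derive_id].
Qed.

Lemma flow_continuous t : continuous (F t).
Proof.
move=> x; have [_ _ [cF _]] := F_flow.
apply: (@continuous_comp _ _ _ (fun x : X => (t, x)) (fun p : R * X => F p.1 p.2)).
  by apply: continuous_pair; [exact: cst_continuous|exact: cvg_id].
exact: cF.
Qed.

Variable G : lieGroupType R.
Local Notation e := (chart_at (1%g : G)).

(** The choice of charts at [phi x] and at [phi x * (phi x)^-1] made by the
    definition of [M_fun] disappears in this description. *)
Lemma M_velocity (phi : X -> G) x : Ck_map 1 (atlas X) (atlas G) phi ->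
  has_velocity e (fun t => (phi (F t x) * (phi x)^-1)%g) (M_fun F phi x).
Proof.
move=> phiC.
have h1 := flow_velocity (atlas_at x) (atlas_at x) (chart_at_dom x) (chart_at_dom x).
have h2 := velocity_push (chart_at_chart x) (Ck_chart_diff_at x phiC) (F0 x) h1.
have h3 : has_velocity (chart_at (phi x)) (phi \o F ^~ x) (lie_deriv F phi x).
  by rewrite /lie_deriv (velocityE h2).
have mr : chart_diff (chart_at (phi x)) (chart_at (phi x * (phi x)^-1)%g)
    (fun g : G => (g * (phi x)^-1)%g) (phi x).
  by apply: mulr_chart_diff => //; exact: atlas_at.
have c0 : (phi \o F ^~ x) 0 = phi x by rewrite /= F0.
have := tangent_map_velocity mr c0 h3.
by rewrite mulgV.
Qed.

(** Near x0 all points can be read in the charts chosen at x0, phi (x0) and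
    phi (x0)^-1.  By uniqueness of velocities, M_phi (x) is there the composition
    of the derivatives of the flow, of phi and of the multiplication, each of
    which is C^1 in these charts. *)
Lemma continuous_M (phi : X -> G) : Ck_map 1 (atlas X) (atlas G) phi ->
  continuous (M_fun F phi : X -> 'rV[R]_(mdim G)).
Proof.
move=> phiC x0.
set c := chart_at x0; set a := chart_at (phi x0); set b := chart_at (phi x0)^-1%g.
have cc : is_chart c by exact: chart_at_chart.
have ca : is_chart a by exact: chart_at_chart.
have cb : is_chart b by exact: chart_at_chart.
have ce : is_chart e by exact: chart_at_chart.
have [cphi Cphi] := phiC.
have cinvphi : continuous (fun x => (phi x)^-1%g).
  move=> x; apply: (@continuous_comp _ _ _ phi (fun g : G => (g^-1)%g)).
    exact: cphi.
  by have [+ _] := @lie_inv_smooth R G 0; apply.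
have near_dom (E : normedModType R) (T : topologicalType) (k : chart E T)
    (f : X -> T) : is_chart k -> continuous f -> cdom k (f x0) ->
    \forall x \near x0, cdom k (f x).
  by move=> [ok _ _ _ _] cf kf; apply: cf; apply: open_nbhs_nbhs.
have nc : \forall x \near x0, cdom c x.
  by apply: (near_dom _ _ _ id) => //; [move=> x; exact: cvg_id|exact: chart_at_dom].
have na : \forall x \near x0, cdom a (phi x).
  by apply: near_dom => //; exact: chart_at_dom.
have nb : \forall x \near x0, cdom b (phi x)^-1%g.
  by apply: near_dom => //; exact: chart_at_dom.
have cmapc : {for x0, continuous (cmap c)}.
  by case: cc => _ _ _ + _; apply; exact: chart_at_dom.
have cmapa : {for x0, continuous (cmap a \o phi)}.
  apply: continuous_comp; first exact: cphi.
  by case: ca => _ _ _ + _; apply; exact: chart_at_dom.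
have cmapb : {for x0, continuous (cmap b \o (fun x => (phi x)^-1%g))}.
  apply: continuous_comp; first exact: cinvphi.
  by case: cb => _ _ _ + _; apply; exact: chart_at_dom.
pose N x := 'd (cmap c \o (fun p : R * X => F p.1 p.2) \o
   cinv (prod_chart (id_chart R) c)) (0, cmap c x) (1, 0).
pose L x := 'd (cmap a \o phi \o cinv c) (cmap c x) (N x).
pose Q x := 'd (cmap e \o (fun z : G * G => (z.1 * z.2)%g) \o
   cinv (prod_chart a b)) (cmap a (phi x), cmap b (phi x)^-1%g)
   (L x, 0).
have MQ : \forall x \near x0, Q x = M_fun F phi x.
  near=> x.
  have cx : cdom c x by near: x.
  have ax : cdom a (phi x) by near: x.
  have bx : cdom b (phi x)^-1%g by near: x.
  have h1 := flow_velocity (atlas_at x0) (atlas_at x0) cx cx.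
  have mphi : chart_diff c a phi x.
    by apply: (Ck_chart_diff phiC) => //; exact: atlas_at.
  have h2 := velocity_push cc mphi (F0 x) h1.
  have h3 := velocity_pair h2 (velocity_cst bx).
  have mm : chart_diff (prod_chart a b) e (fun z : G * G => (z.1 * z.2)%g)
      (phi x, (phi x)^-1%g).
    by apply: mul_chart_diff => //; rewrite ?mulgV;
      do ?exact: atlas_at; exact: chart_at_dom.
  have h4 := velocity_push (is_chart_prod ca cb) mm _ h3.
  by apply: (velocity_unique (h4 _) (M_velocity x phiC)); rewrite /= F0.
rewrite /continuous_at -(nbhs_singleton MQ).
suff cQ : {for x0, continuous Q}.
  by apply: cvg_trans cQ; exact: near_eq_cvg.
have cN : {for x0, continuous N}.
  have [_ _ [_ /(_ (prod_chart (id_chart R) c) c)]] := F_flow.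
  move=> /(_ _ (atlas_at x0)) [].
    by exists (id_chart R), c; split => //; exact: atlas_at.
  move=> dF cF.
  apply: (continuous_derive_comp (conj dF cF)).
    by apply: continuous_pair; [exact: cst_continuous|exact: cmapc].
  apply: filterS nc => x cx; exists (0, x) => //; split => //=.
  by rewrite /preimage /= F0.
have cL : {for x0, continuous L}.
  have Cf := Cphi _ _ (atlas_at x0) (atlas_at (phi x0)).
  apply: (@continuous_diff_apply R _ _ _ _ idfun _ _ _ _ _ Cf) => //.
  by apply: filterS2 nc na => x cx ax; exists x.
apply: (continuous_diff_applyl
  (mul_C1 (atlas_at _) (atlas_at _) (atlas_at _)) _ cL).
  by apply: continuous_pair; [exact: cmapa|exact: cmapb].
near=> x; exists (phi x, (phi x)^-1%g) => //; split => /=.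
  by split; near: x.
by rewrite /preimage /= mulgV; exact: chart_at_dom.
Unshelve. all: by end_near. Qed.

End flow.

(** * Continuity of the adjoint action *)

Section Ad_continuity.
Context {R : realType} (G : lieGroupType R).
Local Notation e := (chart_at (1%g : G)).

(** As for M: near g0, Ad_g v is obtained from v by the derivative of a left
    translation followed by that of a right translation, both read in fixed
    charts. *)
Lemma continuous_Ad (v : lieAlg G) :
  continuous ((fun g : G => Ad g v) : G -> 'rV[R]_(mdim G)).
Proof.
move=> g0.
set a := chart_at g0; set b := chart_at (g0^-1)%g.
have ca : is_chart a by exact: chart_at_chart.
have cb : is_chart b by exact: chart_at_chart.
have ce : is_chart e by exact: chart_at_chart.
have cinvg : continuous (fun g : G => (g^-1)%g).
  by have [] := @lie_inv_smooth R G 0.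
have na : \forall g \near g0, cdom a g.
  by apply: open_nbhs_nbhs; split; [case: ca|exact: chart_at_dom].
have nb : \forall g \near g0, cdom b (g^-1)%g.
  apply: cinvg; apply: open_nbhs_nbhs.
  by split; [case: cb|exact: chart_at_dom].
have cmapa : {for g0, continuous (cmap a)}.
  by case: ca => _ _ _ + _; apply; exact: chart_at_dom.
have cmapb : {for g0, continuous (cmap b \o (fun g => (g^-1)%g))}.
  apply: continuous_comp; first exact: cinvg.
  by case: cb => _ _ _ + _; apply; exact: chart_at_dom.
pose y1 := cmap e 1%g.
pose L g := 'd (cmap a \o (fun z : G * G => (z.1 * z.2)%g) \o
   cinv (prod_chart a e)) (cmap a g, y1) (0, v).
pose Q g := 'd (cmap e \o (fun z : G * G => (z.1 * z.2)%g) \o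
   cinv (prod_chart a b)) (cmap a g, cmap b (g^-1)%g) (L g, 0).
have [c c0 cv] := lieAlg_curve v.
have AQ : \forall g \near g0, Q g = Ad g v.
  near=> g.
  have ag : cdom a g by near: g.
  have bg : cdom b (g^-1)%g by near: g.
  have h1 := velocity_pair (velocity_cst ag) cv.
  have m1 : chart_diff (prod_chart a e) a (fun z : G * G => (z.1 * z.2)%g) (g, 1%g).
    by apply: mul_chart_diff => //; rewrite ?mulg1 //;
      do ?exact: atlas_at; exact: chart_at_dom.
  have h2 := velocity_push (is_chart_prod ca ce) m1 (congr1 (pair g) c0) h1.
  have m2 : chart_diff (prod_chart a b) e (fun z : G * G => (z.1 * z.2)%g) (g, g^-1)%g.
    by apply: mul_chart_diff => //; rewrite ?mulgV;
      do ?exact: atlas_at; exact: chart_at_dom.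
  have h3 := velocity_push (is_chart_prod ca cb) m2 _
    (velocity_pair h2 (velocity_cst bg)).
  by apply: (velocity_unique (h3 _) (Ad_velocity g c0 cv)); rewrite /= c0 mulg1.
rewrite /continuous_at -(nbhs_singleton AQ).
suff cQ : {for g0, continuous Q}.
  by apply: cvg_trans cQ; exact: near_eq_cvg.
have cL : {for g0, continuous L}.
  apply: (continuous_derive_comp
    (mul_C1 (atlas_at _) (atlas_at _) (atlas_at _))).
    by apply: continuous_pair; [exact: cmapa|exact: cst_continuous].
  apply: filterS na => g ag; exists (g, 1%g) => //; split => /=.
    by split => //; exact: chart_at_dom.
  by rewrite /preimage /= mulg1.
apply: (continuous_diff_applyl
  (mul_C1 (atlas_at _) (atlas_at _) (atlas_at _)) _ cL).
  by apply: continuous_pair; [exact: cmapa|exact: cmapb].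
near=> g; exists (g, g^-1)%g => //; split => /=.
  by split; near: g.
by rewrite /preimage /= mulgV; exact: chart_at_dom.
Unshelve. all: by end_near. Qed.

End Ad_continuity.

(** * Behaviour of M under homomorphisms and cohomology *)

Section homs.
Context {R : realType} (X : manifoldType R) (F : R -> X -> X).
Hypothesis F_flow : C1_flow F.

Section lie_homs.
Context (G' G : lieGroupType R) (h : G' -> G).
Hypothesis hh : lie_hom h.
Local Notation e' := (chart_at (1%g : G')).
Local Notation e := (chart_at (1%g : G)).

Lemma lie_hom1 : h 1%g = 1%g.
Proof. by apply: (@mulgI _ (h 1%g)); rewrite -(proj2 hh) !mulg1. Qed.

Lemma lie_homV x : h (x^-1)%g = (h x)^-1%g.
Proof. by apply: (@mulgI _ (h x)); rewrite -(proj2 hh) !mulgV lie_hom1. Qed.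

Lemma hom_velocity c v : c 0 = 1%g -> has_velocity e' c v ->
  has_velocity e (h \o c) (tangent_map h 1%g v).
Proof.
move=> c0 cv; have := tangent_map_velocity (Ck_chart_diff_at 1%g (proj1 hh 1)) c0 cv.
by rewrite lie_hom1.
Qed.

Lemma hom_Ad g v : tangent_map h 1%g (Ad g v) = Ad (h g) (tangent_map h 1%g v).
Proof.
have [c c0 cv] := lieAlg_curve v.
have h1 := Ad_velocity (h g) (_ : (h \o c) 0 = 1%g) (hom_velocity c0 cv).
have h2 := hom_velocity (_ : (fun t => g * c t * g^-1)%g 0 = 1%g) (Ad_velocity g c0 cv).
apply: velocity_unique (h2 _) _; first by rewrite c0 mulg1 mulgV.
have {}h1 := h1 (etrans (congr1 h c0) lie_hom1).
move: h1; congr (has_velocity e _ _).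
by rewrite funeqE => t /=; rewrite !(proj2 hh) lie_homV.
Qed.

(** h maps the curve defining M_delta (x) to the one defining
    M_(h o delta) (x). *)
Lemma M_hom (delta : X -> G') x : Ck_map 1 (atlas X) (atlas G') delta ->
  Ck_map 1 (atlas X) (atlas G) (h \o delta) ->
  M_fun F (h \o delta) x = tangent_map h 1%g (M_fun F delta x).
Proof.
move=> dC hdC.
have F0 : F 0 x = x by case: F_flow.
have h1 := M_velocity F_flow x hdC.
have h2 := hom_velocity _ (M_velocity F_flow x dC).
apply: (velocity_unique h1).
have {}h2 := h2 _.
have : has_velocity e (h \o (fun t : R => (delta (F t x) * (delta x)^-1)%g))
  (tangent_map h 1%g (M_fun F delta x)) by apply: h2; rewrite F0 mulgV.
congr (has_velocity e _ _).
by rewrite funeqE => t /=; rewrite !(proj2 hh) lie_homV.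
Qed.

End lie_homs.

Section cocycle.
Context (G : lieGroupType R) (phi zeta delta : X -> G).
Hypothesis phiC : Ck_map 1 (atlas X) (atlas G) phi.
Hypothesis zetaC : Ck_map 1 (atlas X) (atlas G) zeta.
Hypothesis deltaC : Ck_map 1 (atlas X) (atlas G) delta.
Hypothesis coh : forall x, phi x = ((zeta x)^-1 * delta x * zeta (F 1 x))%g.

(** Both sides are velocities at the identity of one and the same curve:
    delta (F_t x) delta (x)^-1 times the conjugate by delta (x) of
    zeta (F_t F_1 x) zeta (F_1 x)^-1 equals
    zeta (F_t x) zeta (x)^-1 times the conjugate by zeta (x) of
    phi (F_t x) phi (x)^-1. *)
Lemma M_cocycle x : M_fun F delta x + Ad (delta x) (M_fun F zeta (F 1 x)) =
  M_fun F zeta x + Ad (zeta x) (M_fun F phi x).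
Proof.
have [F0 FD _] := F_flow.
have d0 : (fun t => delta (F t x) * (delta x)^-1)%g 0 = 1%g by rewrite F0 mulgV.
have z0 : (fun t => zeta (F t x) * (zeta x)^-1)%g 0 = 1%g by rewrite F0 mulgV.
have p0 : (fun t => phi (F t x) * (phi x)^-1)%g 0 = 1%g by rewrite F0 mulgV.
have y0 : (fun t => zeta (F t (F 1 x)) * (zeta (F 1 x))^-1)%g 0 = 1%g.
  by rewrite F0 mulgV.
have cy0 (c : R -> G) (g : G) : c 0 = 1%g -> (fun t => (g * c t * g^-1)%g) 0 = 1%g.
  by move=> ->; rewrite mulg1 mulgV.
have h1 := mul_velocity d0 (cy0 _ (delta x) y0) (M_velocity F_flow x deltaC)
   (Ad_velocity (delta x) y0 (M_velocity F_flow (F 1 x) zetaC)).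
have h2 := mul_velocity z0 (cy0 _ (zeta x) p0) (M_velocity F_flow x zetaC)
   (Ad_velocity (zeta x) p0 (M_velocity F_flow x phiC)).
apply: (velocity_unique h1); move: h2; congr (has_velocity _ _ _).
rewrite funeqE => t /=.
have FC : F 1 (F t x) = F t (F 1 x) by rewrite -!FD addrC.
by rewrite !coh FC !invgM invgK !mulgA !mulgVK !mulgK mulgV mul1g.
Qed.

End cocycle.
End homs.

(** * Complex matrices as a real normed space *)

Section cmatrices.
Context {R : realType} (d : nat).
Local Notation M := (cmat R d).

Lemma of_cmatK (Z : M) : to_cmat (of_cmat Z) = Z.
Proof. by case: Z => A B; congr pair; apply/matrixP => i j; rewrite !mxE. Qed.

Lemma to_cmatK (A : 'M[R[i]]_d) : of_cmat (to_cmat A) = A.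
Proof. by apply/matrixP => i j; rewrite !mxE; case: (A i j). Qed.

Lemma of_cmat_linear k (Z W : M) :
  of_cmat (k *: Z + W) = (real_complex R k) *: of_cmat Z + of_cmat W.
Proof.
apply/matrixP => i j; rewrite !mxE /=; apply/eqP; rewrite eq_complex /=.
by rewrite !mul0r subr0 addr0 !eqxx.
Qed.

Lemma to_cmat_linear k (A B : 'M[R[i]]_d) :
  to_cmat ((real_complex R k) *: A + B) = k *: to_cmat A + to_cmat B.
Proof. by rewrite -[RHS]of_cmatK of_cmat_linear !to_cmatK. Qed.

Lemma cmat_expand (W : lmodType R) (L : M -> W) (Llin : linear L) (Z : M) :
  L Z = \sum_i \sum_j (Z.1 i j *: L (delta_mx i j, 0)
                       + Z.2 i j *: L (0, delta_mx i j)).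
Proof.
pose L' : {linear M -> W} := HB.pack L (GRing.isLinear.Build _ _ _ _ _ Llin).
rewrite -[L]/(L' : M -> W).
have {1}-> : Z = \sum_i \sum_j (Z.1 i j *: (delta_mx i j, 0)
                       + Z.2 i j *: (0, delta_mx i j)).
  rewrite {1}(surjective_pairing Z) {1}(matrix_sum_delta Z.1) {1}(matrix_sum_delta Z.2).
  apply/eqP; rewrite -pair_eqE; apply/andP; split; apply/eqP => /=.
    rewrite (raddf_sum (@fst _ _)) /=; apply: eq_bigr => i _.
    rewrite (raddf_sum (@fst _ _)) /=; apply: eq_bigr => j _.
    by rewrite scaler0 addr0.
  rewrite (raddf_sum (@snd _ _)) /=; apply: eq_bigr => i _.
  rewrite (raddf_sum (@snd _ _)) /=; apply: eq_bigr => j _.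
  by rewrite scaler0 add0r.
rewrite linear_sum; apply: eq_bigr => i _.
rewrite linear_sum; apply: eq_bigr => j _.
by rewrite linearD !linearZ.
Qed.

Lemma cmat_sum_continuous (T : topologicalType) (W : normedModType R)
    (f : T -> M) (a b : 'I_d -> 'I_d -> T -> W) (x : T) :
  {for x, continuous f} ->
  (forall i j, {for x, continuous (a i j)}) ->
  (forall i j, {for x, continuous (b i j)}) ->
  {for x, continuous (fun y => \sum_i \sum_j ((f y).1 i j *: a i j y
                       + (f y).2 i j *: b i j y))}.
Proof.
move=> cf ca cb; apply: cvg_big => [|i _]; first exact: add_continuous.
apply: cvg_big => [|j _]; first exact: add_continuous.
apply: cvgD; apply: cvgZ; [|exact: ca| |exact: cb].
  apply: (@continuous_comp _ _ _ f (fun Z : M => Z.1 i j)) => //.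
  apply: (@continuous_comp _ _ _ fst (fun A : 'M[R]_d => A i j)).
    exact: cvg_fst.
  exact: coord_continuous.
apply: (@continuous_comp _ _ _ f (fun Z : M => Z.2 i j)) => //.
apply: (@continuous_comp _ _ _ snd (fun A : 'M[R]_d => A i j)).
  exact: cvg_snd.
exact: coord_continuous.
Qed.

Lemma cmat_linear_continuous (W : normedModType R) (L : M -> W) :
  linear L -> continuous L.
Proof.
move=> Llin Z; rewrite (funext (cmat_expand Llin)).
apply: (@cmat_sum_continuous _ _ id (fun i j => cst (L (delta_mx i j, 0)))
   (fun i j => cst (L (0, delta_mx i j)))).
- exact: cvg_id.
- by move=> i j; exact: cst_continuous.
- by move=> i j; exact: cst_continuous.
Qed.

Definition cmat_mul (Z W : M) : M := to_cmat (of_cmat Z *m of_cmat W).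

Lemma cmat_mul_linearl (W : M) : linear (cmat_mul^~ W).
Proof.
by move=> k Z Z'; rewrite /cmat_mul of_cmat_linear mulmxDl -scalemxAl to_cmat_linear.
Qed.

Lemma cmat_mul_linearr (Z : M) : linear (cmat_mul Z).
Proof.
by move=> k W W'; rewrite /cmat_mul of_cmat_linear mulmxDr -scalemxAr to_cmat_linear.
Qed.

Lemma cmat_mul_continuous : continuous (fun p : M * M => cmat_mul p.1 p.2).
Proof.
move=> p; rewrite (funext (fun p : M * M => cmat_expand (cmat_mul_linearl p.2) p.1)).
apply: (@cmat_sum_continuous _ _ fst
   (fun i j (p : M * M) => cmat_mul (delta_mx i j, 0) p.2)
   (fun i j p => cmat_mul (0, delta_mx i j) p.2)).
- exact: cvg_fst.
- move=> i j; apply: (@continuous_comp _ _ _ snd (cmat_mul (delta_mx i j, 0))).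
    exact: cvg_snd.
  exact: (cmat_linear_continuous (cmat_mul_linearr _)).
- move=> i j; apply: (@continuous_comp _ _ _ snd (cmat_mul (0, delta_mx i j))).
    exact: cvg_snd.
  exact: (cmat_linear_continuous (cmat_mul_linearr _)).
Qed.

Lemma is_derive_cmat_mul (f g : R -> M) (t : R) (f' g' : M) :
  is_derive t 1 f f' -> is_derive t 1 g g' ->
  is_derive t 1 (fun s => cmat_mul (f s) (g s)) (cmat_mul (f t) g' + cmat_mul f' (g t)).
Proof.
move=> [/derivable1_diffP df <-] [/derivable1_diffP dg <-].
have bil : bilinear_for *:%R *:%R cmat_mul.
  by split => u; [exact: cmat_mul_linearl|exact: cmat_mul_linearr].
pose B : {bilinear M -> M -> M} :=
  HB.pack cmat_mul (bilinear_isBilinear.Build _ _ _ _ _ _ _ bil).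
have cB : continuous (fun p : M * M => B p.1 p.2) by exact: cmat_mul_continuous.
have dfg : differentiable (fun s => (f s, g s)) t.
  exact: differentiable_pair df dg.
have dB : differentiable (fun p : M * M => B p.1 p.2) (f t, g t).
  exact: (@differentiable_bilin _ _ _ _ B (f t, g t) cB).
have E : (fun s => cmat_mul (f s) (g s)) =
    (fun p : M * M => B p.1 p.2) \o (fun s => (f s, g s)) by [].
have dc : differentiable (fun s => cmat_mul (f s) (g s)) t.
  rewrite E; exact: differentiable_comp dfg dB.
apply: DeriveDef; first exact: (proj2 (derivable1_diffP _ _) dc).
rewrite (deriveE _ dc) E (diff_comp dfg dB) /= (diff_bilin _ cB).
by rewrite /= (diff_pair df dg) /= (deriveE _ df) (deriveE _ dg).
Qed.

End cmatrices.

Section C1_curves.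
Context {R : realType}.

Lemma is_derive_linear (E E' : normedModType R) (L : E -> E') (Llin : linear L)
    (c : R -> E) (t : R) v : continuous L ->
  is_derive t 1 c v -> is_derive t 1 (L \o c) (L v).
Proof.
move=> cL dc.
pose L' : {linear E -> E'} := HB.pack L (GRing.isLinear.Build _ _ _ _ _ Llin).
have dL : differentiable L' (c t) by exact: linear_differentiable.
by have := is_derive_diff dL dc; rewrite diff_lin.
Qed.

Variable W : normedModType R.

(** For functions of a real variable, all directional derivatives are multiples
    of a single derivative. *)
Lemma Ck1_curveP (f : R -> W) :
  Ck 1 setT f <->
  exists2 f' : R -> W, (forall t : R, is_derive t 1 f (f' t)) & continuous f'.
Proof.
split=> [[df cf]|[f' df cf]].
  exists (fun t => 'D_1 f t); last by move=> t; exact: cf.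
  by move=> t; apply: derivableP; apply/derivable1_diffP; exact: df.
have dff t : differentiable f t by apply/derivable1_diffP; have [] := df t.
split => // v t _.
have -> : (fun x => 'D_v f x) = (fun x => v *: f' x).
  rewrite funeqE => s; rewrite deriveE // -[v in LHS]mulr1.
  have -> : v * 1 = v *: (1 : R) by [].
  by rewrite linearZ -deriveE //; have [_ ->] := df s.
by apply: cvgZl_tmp; exact: cf.
Qed.

End C1_curves.

(** * The Lie algebra of a matrix group *)

Section matrix_lie_algebra.
Context {R : realType} (G : lieGroupType R) (d : nat) (rho : G -> 'M[R[i]]_d).
Local Notation M := (cmat R d).
Local Notation S := (mx_lieAlg (range rho)).
Local Notation e := (chart_at (1%g : G)).
Hypothesis rho1 : rho 1%g = 1%:M.
Hypothesis rhoM : forall x y, rho (x * y)%g = rho x *m rho y.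

Lemma rhoV x : rho (x^-1)%g = invmx (rho x).
Proof.
have h : rho x *m rho (x^-1)%g = 1%:M by rewrite -rhoM mulgV.
have /mulmx1_unit[u _] := h.
by rewrite -[LHS](mulKmx u) h mulmx1.
Qed.

(** The product of two curves through the identity has the sum of their
    velocities as velocity. *)
Lemma mx_lieAlgD u v : S u -> S v -> S (u + v).
Proof.
move=> [c [c0 cr /Ck1_curveP[c' dc cc'] ->]].
move=> [b [b0 br /Ck1_curveP[b' db cb'] ->]].
have E : (fun t => to_cmat (c t *m b t)) =
    (fun t => cmat_mul (to_cmat (c t)) (to_cmat (b t))).
  by rewrite funeqE => t; rewrite /cmat_mul !to_cmatK.
exists (fun t => c t *m b t); split.
- by rewrite c0 b0 mulmx1.
- move=> t; have [x _ <-] := cr t; have [y _ <-] := br t.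
  by exists (x * y)%g.
- apply/Ck1_curveP; rewrite E.
  exists (fun t => cmat_mul (to_cmat (c t)) (b' t) + cmat_mul (c' t) (to_cmat (b t))).
    by move=> t; exact: is_derive_cmat_mul.
  have cont (f f' : R -> M) :
      (forall t : R, is_derive t 1 f (f' t)) -> continuous f.
    move=> df t; have [dft _] := df t.
    by apply: differentiable_continuous; exact/derivable1_diffP.
  have cm (f g : R -> M) : continuous f -> continuous g ->
      continuous (fun t => cmat_mul (f t) (g t)).
    move=> cf cg t; apply: (@continuous_comp _ _ _ (fun t => (f t, g t))
                             (fun p : M * M => cmat_mul p.1 p.2)).
      by apply: continuous_pair; [exact: cf|exact: cg].
    exact: cmat_mul_continuous.
  by move=> t; apply: cvgD; apply: cm => //; apply: cont; eassumption.
- rewrite !derive1E; have [_ ->] := dc 0; have [_ ->] := db 0.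
  rewrite E; have [_ ->] := is_derive_cmat_mul (dc 0) (db 0).
  by rewrite c0 b0 /cmat_mul !to_cmatK mulmx1 mul1mx !of_cmatK addrC.
Qed.

(** Apply to the curve the map of the group which L linearizes. *)
Lemma mx_lieAlgL (L : M -> M) (T : 'M[R[i]]_d -> 'M[R[i]]_d) u :
  linear L -> (forall A, to_cmat (T A) = L (to_cmat A)) -> T 1%:M = 1%:M ->
  (forall A, range rho A -> range rho (T A)) -> S u -> S (L u).
Proof.
move=> Llin TL T1 Tr [c [c0 cr /Ck1_curveP[c' dc cc'] ->]].
have cL := cmat_linear_continuous Llin.
have E : (fun t => to_cmat (T (c t))) = L \o (fun t => to_cmat (c t)).
  by rewrite funeqE => t; rewrite TL.
have dL (t : R) := is_derive_linear Llin cL (dc t).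
exists (T \o c); split => /=.
- by rewrite c0.
- by move=> t; apply: Tr.
- rewrite E; apply/Ck1_curveP; exists (L \o c') => // t.
  by apply: continuous_comp; [exact: cc'|exact: cL].
- rewrite !derive1E E; have [_ ->] := dL 0.
  by have [_ ->] := dc 0.
Qed.

(** Rescale the time of the curve. *)
Lemma mx_lieAlgZ k u : S u -> S (k *: u).
Proof.
move=> [c [c0 cr /Ck1_curveP[c' dc cc'] ->]].
have dk (t : R) :
    is_derive t 1 (fun s : R => to_cmat (c (k * s))) (k *: c' (k * t)).
  have [/derivable1_diffP dct <-] := dc (k * t).
  have dm : is_diff t ( *:%R k : R -> R) ( *:%R k) by exact: is_diff_scaler.
  have E : (fun s : R => to_cmat (c (k * s))) =
      (fun t => to_cmat (c t)) \o ( *:%R k : R -> R) by [].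
  have dd : differentiable (fun s : R => to_cmat (c (k * s))) t.
    by rewrite E; exact: differentiable_comp.
  apply: DeriveDef; first exact/derivable1_diffP.
  rewrite deriveE // E diff_comp //= diff_val linearZ /=.
  by rewrite -[_ *: t]/(k * t) -deriveE.
exists (fun t => c (k * t)); split => //.
- by rewrite mulr0.
- apply/Ck1_curveP; exists (fun t => k *: c' (k * t)) => // t.
  apply: cvgZl_tmp; apply: (@continuous_comp _ _ _ ( *%R k)).
    exact: (@scaler_continuous R R^o k).
  exact: cc'.
- rewrite !derive1E; have [_ ->] := dk 0; have [_ ->] := dc 0.
  by rewrite mulr0.
Qed.

Lemma mx_lieAlg0 : S 0.
Proof.
exists (fun=> 1%:M); split => //.
- by move=> t; exists 1%g.
- apply/Ck1_curveP; exists (fun=> 0) => t; first exact: is_derive_cst.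
  exact: cst_continuous.
- by rewrite derive1_cst.
Qed.

Lemma Ad_mx_linear (A : 'M[R[i]]_d) : linear (Ad_mx A).
Proof.
move=> k u v.
by rewrite /Ad_mx of_cmat_linear mulmxDr mulmxDl -scalemxAr -scalemxAl to_cmat_linear.
Qed.

Lemma mx_lieAlg_Ad g u : S u -> S (Ad_mx (rho g) u).
Proof.
apply: (mx_lieAlgL (T := fun A => rho g *m A *m invmx (rho g))).
- exact: Ad_mx_linear.
- by move=> A; rewrite /Ad_mx to_cmatK.
- by rewrite mulmx1 -rhoV -rhoM mulgV.
- by move=> _ [x _ <-]; exists (g * x * g^-1)%g => //; rewrite !rhoM rhoV.
Qed.

Hypothesis rhoC : Ck_map 1 (atlas G) (vec_atlas M) (fun g => to_cmat (rho g)).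

Lemma rep_chart_diff p :
  chart_diff (chart_at p) (id_chart M) (fun g => to_cmat (rho g)) p.
Proof. exact: (Ck_chart_diff rhoC). Qed.

(** A curve in G defined for all times is needed.  In a chart it is
    t |-> y0 + eps sin (t / eps) v, which stays in the image of the chart when
    eps is small and has velocity v at 0. *)
Lemma mx_lieAlg_tangent v : S (tangent_map_vec (fun g : G => to_cmat (rho g)) 1%g v).
Proof.
have [ce oe ie cce cie] := chart_at_chart (1%g : G).
set y0 := cmap e 1%g.
have Uy0 : (cmap e @` cdom e) y0 by exists 1%g => //; exact: chart_at_dom.
have [r r0 ballU] : exists2 r : R, 0 < r &
    forall y, `|y| < r -> (cmap e @` cdom e) (y0 + y).
  have /nbhs_ballP[r /= r0 br] : nbhs y0 (cmap e @` cdom e) by exact: open_nbhs_nbhs.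
  exists r => // y yr; apply: br; rewrite -ball_normE /=.
  by rewrite opprD addrA subrr add0r normrN.
(* with this eps, |eps sin (t / eps) v| < r for all t *)
pose eps := r / (`|v| + 1) : R.
have v1 : 0 < `|v| + 1 by rewrite ltr_wpDl.
have eps0 : 0 < eps by rewrite divr_gt0.
pose gam (t : R) := eps * sin (eps^-1 * t).
pose kap (t : R) : 'rV[R]_(mdim G) := y0 + gam t *: v.
have dgam (t : R) : is_derive t 1 gam (cos (eps^-1 * t)).
  have h1 : is_derive t 1 ( *%R eps^-1) eps^-1.
    have dm : is_diff t ( *:%R eps^-1 : R -> R) ( *:%R eps^-1) by exact: is_diff_scaler.
    apply: DeriveDef; first exact/derivable1_diffP.
    rewrite deriveE // -[ *%R eps^-1]/( *:%R eps^-1) diff_val.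
    exact: mulr1.
  have h2 : is_derive t 1 (sin \o ( *%R eps^-1)) (cos (eps^-1 * t) * eps^-1).
    exact: is_derive1_comp.
  have := is_deriveZ eps h2; congr (is_derive _ _ _ _).
  by rewrite -[_ *: _]/(eps * _) mulrC mulfVK // gt_eqF.
have kapU t : (cmap e @` cdom e) (kap t).
  apply: ballU; rewrite normrZ normrM (gtr0_norm eps0).
  apply: (@le_lt_trans _ _ (eps * `|v|)).
    by rewrite -mulrA ler_pM2l // ler_piMl // sin_max.
  by rewrite /eps mulrAC ltr_pdivrMr // ltr_pM2l // ltrDl.
have cgam : continuous (fun t => cos (eps^-1 * t)).
  move=> t; apply: (@continuous_comp _ _ _ ( *%R eps^-1) cos).
    exact: (@scaler_continuous R R^o eps^-1).
  exact: continuous_cos.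
have dkap (t : R) : is_derive t 1 kap (cos (eps^-1 * t) *: v).
  rewrite -[X in is_derive _ _ _ X]add0r.
  exact: (is_deriveD (is_derive_cst y0 t 1) (is_derive_scalel v (dgam t))).
have kap0 : kap 0 = y0 by rewrite /kap /gam mulr0 sin0 mulr0 scale0r addr0.
pose f : 'rV[R]_(mdim G) -> M := id \o (fun g : G => to_cmat (rho g)) \o cinv e.
have Cf : Ck 1 (cmap e @` cdom e) f.
  have [_ /(_ e (id_chart M) (atlas_at _) erefl)] := rhoC.
  by rewrite (_ : _ @^-1` _ = setT) ?setIT.
have df t : differentiable f (kap t) by have [+ _] := Cf; apply.
have dc t := is_derive_diff (df t) (dkap t).
exists (fun t => rho (cinv e (kap t))); split => //.
- by rewrite kap0 /y0 (ie _ (chart_at_dom _)).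
- apply/Ck1_curveP; exists (fun t => 'd f (kap t) (cos (eps^-1 * t) *: v)).
    exact: dc.
  move=> t; rewrite (_ : (fun t => _) =
      (fun t => cos (eps^-1 * t) *: 'd f (kap t) v)); last first.
    by rewrite funeqE => s; rewrite linearZ.
  apply: cvgZ; first exact: cgam.
  have nU : \forall s \near t, (cmap e @` cdom e) (kap s) by near do exact: kapU.
  apply: (continuous_derive_comp Cf _ nU).
  have [dk _] := dkap t.
  by apply: differentiable_continuous; exact: (proj1 (derivable1_diffP _ _) dk).
- rewrite derive1E; have [_ ->] := dc 0.
  by rewrite mulr0 cos0 scale1r kap0.
Unshelve. all: by end_near. Qed.

Lemma rep_velocity c v : c 0 = 1%g -> has_velocity e c v ->
  has_velocity (id_chart M) (fun t => to_cmat (rho (c t)))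
    (tangent_map_vec (fun g : G => to_cmat (rho g)) 1%g v).
Proof. by move=> c0 cv; apply: (velocity_push _ (rep_chart_diff 1%g) c0 cv). Qed.

End matrix_lie_algebra.

Section representations.
Context {R : realType} (G : lieGroupType R) (d : nat) (rho : G -> 'M[R[i]]_d).
Local Notation M := (cmat R d).
Local Notation e := (chart_at (1%g : G)).
Hypothesis rho1 : rho 1%g = 1%:M.
Hypothesis rhoM : forall x y, rho (x * y)%g = rho x *m rho y.
Hypothesis rhoC : Ck_map 1 (atlas G) (vec_atlas M) (fun g => to_cmat (rho g)).
Local Notation drho := (tangent_map_vec (fun g : G => to_cmat (rho g)) 1%g).

(** rho maps the conjugate of a curve by g to its conjugate by rho g, and a
    linear map commutes with velocities. *)
Lemma rep_Ad_mx g v : drho (Ad g v) = Ad_mx (rho g) (drho v).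
Proof.
have [c c0 cv] := lieAlg_curve v.
have c10 : (fun t => g * c t * g^-1)%g 0 = 1%g by rewrite c0 mulg1 mulgV.
have h1 := rep_velocity rhoC c10 (Ad_velocity g c0 cv).
have [_ _ h2] := rep_velocity rhoC c0 cv.
apply: (velocity_unique h1); split => //; first by case: h1.
have Alin := @Ad_mx_linear _ d (rho g).
have := is_derive_linear Alin (cmat_linear_continuous Alin) h2.
congr (is_derive _ _ _ _).
by rewrite funeqE => t /=; rewrite /Ad_mx to_cmatK !rhoM (rhoV rho1 rhoM).
Qed.

(** On the matrix side, right translation by a fixed matrix is linear, hence it
    commutes with the derivative in time. *)
Lemma M_mx_rep (X : manifoldType R) (F : R -> X -> X) (phi : X -> G) x :
  C1_flow F -> Ck_map 1 (atlas X) (atlas G) phi ->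
  M_mx F (rho \o phi) x = drho (M_fun F phi x).
Proof.
move=> F_flow phiC.
have F0 : F 0 x = x by case: F_flow.
have c0 : (fun t => phi (F t x) * (phi x)^-1)%g 0 = 1%g by rewrite F0 mulgV.
have [_ _ h] := rep_velocity rhoC c0 (M_velocity F_flow x phiC).
have Llin := cmat_mul_linearl (to_cmat (rho (phi x))).
have := is_derive_linear Llin (cmat_linear_continuous Llin) h.
have E : (cmat_mul (d:=d))^~ (to_cmat (rho (phi x))) \o
    (cmap (id_chart M) \o (fun t : R => to_cmat (rho (phi (F t x) / phi x)%g))) =
    (fun t => to_cmat (rho (phi (F t x)))).
  rewrite funeqE => t; rewrite /= /cmat_mul !to_cmatK.
  by rewrite -rhoM mulgVK.
rewrite E.
move=> [_ h2].
rewrite /M_mx /lie_deriv_mx derive1E /= h2 /cmat_mul !to_cmatK.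
have u : rho (phi x) \in unitmx.
  have /mulmx1_unit[] // : rho (phi x) *m rho (phi x)^-1%g = 1%:M.
  by rewrite -rhoM mulgV.
by rewrite mulmxK // of_cmatK.
Qed.

Lemma rep_hom (G' : lieGroupType R) (h : G' -> G) v : lie_hom h ->
  tangent_map_vec (fun g : G' => to_cmat (rho (h g))) 1%g v =
  drho (tangent_map h 1%g v).
Proof.
move=> hh; have [c c0 cv] := lieAlg_curve v.
have h1 := rep_velocity rhoC (etrans (congr1 h c0) (lie_hom1 hh)) (hom_velocity hh c0 cv).
have m2 : chart_diff (chart_at (1%g : G')) (id_chart M)
    (fun g : G' => to_cmat (rho (h g))) 1%g.
  apply: (@chart_diff_comp _ _ _ _ _ _ _ (chart_at (1%g : G')) (chart_at (h 1%g))
     (id_chart M) h (fun g : G => to_cmat (rho g))) => //.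
    exact: (Ck_chart_diff_at 1%g (proj1 hh 1)).
  exact: rep_chart_diff.
have h2 := velocity_push (chart_at_chart _) m2 c0 cv.
exact: (velocity_unique h2 h1).
Qed.

End representations.

(** * Borel functions with values in row vectors *)

Section borel_measurability.
Context {R : realType}.

Lemma borel_open_measurable (V : ptopologicalType) (A : set (borel V)) :
  open (A : set V) -> measurable A.
Proof. by move=> oA; exact: sub_sigma_algebra. Qed.

Lemma measurable_borelP (d : measure_display) (T : measurableType d)
    (V : ptopologicalType) (f : T -> V) :
  (forall A : set V, open A -> measurable (f @^-1` A)) ->
  measurable_fun setT (f : T -> borel V).
Proof.
move=> fA; apply: (@measurability _ _ T (borel V) setT f (@open V)) => //.
by move=> _ [A oA <-]; rewrite setTI; exact: fA.
Qed.

Lemma continuous_borel (V W : ptopologicalType) (f : V -> W) :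
  continuous f -> measurable_fun setT (f : borel V -> borel W).
Proof.
move=> cf; apply: measurable_borelP => A oA.
by apply: borel_open_measurable; apply: open_comp => // x _; exact: cf.
Qed.

Lemma continuous_borel_normed (V W : normedModType R) (f : V -> W) :
  continuous f -> measurable_fun setT (f : borel V -> borel W).
Proof. exact: continuous_borel. Qed.

(** R carries the sigma-algebra generated by intervals, not [borel R]. *)
Lemma measurable_borel_real (d : measure_display) (T : measurableType d)
    (V : ptopologicalType) (f : T -> V) (g : V -> R) :
  measurable_fun setT (f : T -> borel V) -> continuous g ->
  measurable_fun setT (g \o f).
Proof.
move=> mf cg; apply: (measurability _ (RGenOpens.measurableE R)).
move=> _ [A [a [b ->]] <-].
rewrite setTI comp_preimage -[X in measurable X]setTI; apply: mf => //.
apply: borel_open_measurable; apply: open_comp => [x _|]; first exact: cg.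
exact: interval_open.
Qed.

Lemma measurable_coord (d : measure_display) (T : measurableType d) n
    (f : T -> 'rV[R]_n) (i : 'I_n) :
  measurable_fun setT (f : T -> borel 'rV[R]_n) ->
  measurable_fun setT (fun x => f x 0 i).
Proof.
by move=> mf; apply: (measurable_borel_real mf (@coord_continuous _ _ _ 0 i)).
Qed.

(** Row vectors with real entries are second countable: an open set is the union
    of the balls with rational centre and radius 1 / (k + 1) that it contains,
    and such a ball is a box. *)
Lemma measurable_rV (d : measure_display) (T : measurableType d) n
    (f : T -> 'rV[R]_n) :
  (forall i, measurable_fun setT (fun x => f x 0 i)) ->
  measurable_fun setT (f : T -> borel 'rV[R]_n).
Proof.
move=> mf; apply: measurable_borelP => A oA.
pose qv (q : 'rV[rat]_n) : 'rV[R]_n := map_mx ratr q.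
pose box (p : 'rV[rat]_n * nat) := ball (qv p.1) (p.2.+1%:R^-1 : R).
have mbox p : measurable (f @^-1` box p).
  have -> : f @^-1` box p = \bigcap_(i in [set: 'I_n])
      (fun x => f x 0 i) @^-1` ball (qv p.1 0 i) (p.2.+1%:R^-1 : R).
    apply/seteqP; split => x /=.
      by move=> [_ h] i _; exact: h.
    move=> h; split; first by rewrite invr_gt0.
    by move=> i j; rewrite (ord1 i); exact: h.
  apply: fin_bigcap_measurable => // i _.
  rewrite -[X in measurable X]setTI; apply: mf => //.
  exact: measurable_ball.
have -> : f @^-1` A = \bigcup_p (if `[< box p `<=` A >] then f @^-1` box p else set0).
  apply/seteqP; split => [x /= Ax|x [p _]]; last first.
    by case: ifPn => // /asboolP pA /pA.
  have /nbhs_ballP[r /= r0 rA] : nbhs (f x) A by exact: open_nbhs_nbhs.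
  (* points of a rational ball containing f x are within twice its radius of f x *)
  have [k kr] : exists k : nat, (k.+1%:R^-1 : R) < r / 2.
    have [k] := ltr_add_invr (y := 0) (x := r / 2) (divr_gt0 r0 (ltr0Sn _ _)).
    by rewrite add0r; exists k.
  have k0 : (0 : R) < k.+1%:R^-1 by rewrite invr_gt0.
  have qex i : exists q : rat, ball (f x 0 i) (k.+1%:R^-1 : R) (ratr q : R).
    have /rat_in_itvoo[q qi] : f x 0 i - k.+1%:R^-1 < f x 0 i + k.+1%:R^-1.
      by rewrite ltrBlDr -addrA ltrDl addr_gt0.
    exists q; move: qi; rewrite in_itv /= => /andP[h1 h2].
    by rewrite /ball /= ltr_distlC h1 h2.
  have [q hq] := choice qex.
  pose qx : 'rV[rat]_n := \row_i q i.
  have bx : ball (qv qx) (k.+1%:R^-1 : R) (f x).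
    split => // i j; rewrite (ord1 i) !mxE.
    exact/ball_sym/hq.
  exists (qx, k) => //.
  rewrite asboolT // => y by_; apply: rA.
  apply: (@le_ball _ _ _ (k.+1%:R^-1 + k.+1%:R^-1)).
    by rewrite ltW // [ltRHS]splitr ltrD.
  exact: ball_triangle (ball_sym bx) by_.
apply: countable_bigcupT_measurable.
  exact: countableP.
by move=> p; case: ifPn => // _; exact: measurable0.
Qed.

Lemma measurable_linear_family (d : measure_display) (T : measurableType d) n m
    (A : T -> 'rV[R]_n -> 'rV[R]_m) (f : T -> 'rV[R]_n) :
  (forall x, linear (A x)) ->
  (forall v, measurable_fun setT (fun x => A x v : borel 'rV[R]_m)) ->
  measurable_fun setT (f : T -> borel 'rV[R]_n) ->
  measurable_fun setT (fun x => A x (f x) : borel 'rV[R]_m).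
Proof.
move=> Alin mA mf; apply: measurable_rV => j.
have E x : A x (f x) 0 j = \sum_i f x 0 i * A x (delta_mx 0 i) 0 j.
  rewrite (linear_fun_rV (f x) (Alin x)) summxE.
  by apply: eq_bigr => i _; rewrite mxE.
under eq_fun do rewrite E.
apply: measurable_sum => i; apply: measurable_funM.
  exact: measurable_coord.
exact: (measurable_coord j (mA (delta_mx 0 i))).
Qed.

End borel_measurability.

(** * Scalar products on row vectors *)

Section scalar_product_theory.
Context {R : realType} (n : nat) (ip : 'rV[R]_n -> 'rV[R]_n -> R).
Hypothesis ipS : scalar_product setT ip.
Implicit Types u v w : 'rV[R]_n.

Lemma ipC u v : ip u v = ip v u. Proof. by case: ipS => + _ _; apply. Qed.

Lemma ip_linear w : linear (ip^~ w : 'rV[R]_n -> R^o).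
Proof. by case: ipS => _ + _ a u v; apply. Qed.

Lemma ip0l w : ip 0 w = 0.
Proof.
have := ip_linear w 1 0 0; rewrite !scale1r addr0 => h.
by apply: (addrI (ip 0 w)); rewrite addr0 -h.
Qed.

Lemma ipZl a u w : ip (a *: u) w = a * ip u w.
Proof. by have := ip_linear w a u 0; rewrite addr0 ip0l addr0. Qed.

Lemma ipDl u v w : ip (u + v) w = ip u w + ip v w.
Proof. by have := ip_linear w 1 u v; rewrite !scale1r. Qed.

Lemma ipNl u w : ip (- u) w = - ip u w.
Proof. by rewrite -scaleN1r ipZl mulN1r. Qed.

Lemma ipBl u v w : ip (u - v) w = ip u w - ip v w.
Proof. by rewrite ipDl ipNl. Qed.

Lemma ipDr u v w : ip w (u + v) = ip w u + ip w v.
Proof. by rewrite ipC ipDl !(ipC w). Qed.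

Lemma ipZr a u w : ip w (a *: u) = a * ip w u.
Proof. by rewrite ipC ipZl (ipC w). Qed.

Lemma ipBr u v w : ip w (u - v) = ip w u - ip w v.
Proof. by rewrite ipC ipBl !(ipC w). Qed.

Lemma ip_ge0 u : 0 <= ip u u.
Proof.
have [->|u0] := eqVneq u 0; first by rewrite ip0l.
by apply: ltW; case: ipS => _ _; apply.
Qed.

Lemma ip_eq0 u : ip u u = 0 -> u = 0.
Proof.
move=> uu; apply/eqP; apply: contraT => u0.
by case: ipS => _ _ /(_ u I u0); rewrite uu ltxx.
Qed.

Lemma ip_suml k (f : 'I_k -> 'rV[R]_n) w : ip (\sum_i f i) w = \sum_i ip (f i) w.
Proof. by elim/big_ind2 : _ => [|x1 x2 y1 y2 <- <-|//]; rewrite ?ip0l ?ipDl. Qed.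

Lemma ip_sumr k (f : 'I_k -> 'rV[R]_n) w : ip w (\sum_i f i) = \sum_i ip w (f i).
Proof. by rewrite ipC ip_suml; apply: eq_bigr => i _; rewrite ipC. Qed.

Lemma ipE u v : ip u v =
  \sum_i \sum_j u 0 i * v 0 j * ip (delta_mx 0 i) (delta_mx 0 j).
Proof.
rewrite {1}(row_sum_delta u) ip_suml; apply: eq_bigr => i _.
rewrite ipZl {1}(row_sum_delta v) ipC ip_suml mulr_sumr; apply: eq_bigr => j _.
by rewrite ipZl ipC mulrA.
Qed.

(** The integrable bound for products of square integrable functions. *)
Lemma ip_young u v : `|ip u v| <= ip u u + ip v v.
Proof.
have h1 := ip_ge0 (u - v); have h2 := ip_ge0 (u + v).
rewrite !(ipBl, ipBr, ipDl, ipDr) (ipC v u) in h1 h2.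
have hu := ip_ge0 u; have hv := ip_ge0 v.
by rewrite ler_norml; apply/andP; split; lra.
Qed.

Lemma ip_sqD u v : ip (u + v) (u + v) <= 2 * (ip u u + ip v v).
Proof.
have h1 := ip_ge0 (u - v).
by rewrite !(ipBl, ipBr, ipDl, ipDr) (ipC v u) in h1 *; lra.
Qed.

(** A vector in the kernel of the Gram matrix is orthogonal to itself. *)
Lemma ip_gram_unit : (\matrix_(i, j) ip (delta_mx 0 i) (delta_mx 0 j)) \in unitmx.
Proof.
rewrite -row_free_unit -kermx_eq0; apply/eqP/row_matrixP => k.
set K := kermx _; set A := \matrix_(i, j) _ in K *.
have kA : row k K *m A = 0 by rewrite -row_mul mulmx_ker row0.
rewrite row0; apply: ip_eq0.
rewrite ipE exchange_big /= big1 // => j _.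
have /rowP/(_ j) := kA; rewrite !mxE => kAj.
under eq_bigr do rewrite mulrAC.
rewrite -mulr_suml.
have -> : \sum_i row k K 0 i * ip (delta_mx 0 i) (delta_mx 0 j) = 0.
  by rewrite -[RHS]kAj; apply: eq_bigr => i _; rewrite [A i j]mxE.
by rewrite mul0r.
Qed.

Lemma ip_continuous_comp (T : topologicalType) (f g : T -> 'rV[R]_n) x :
  {for x, continuous f} -> {for x, continuous g} ->
  {for x, continuous (fun y => ip (f y) (g y))}.
Proof.
move=> cf cg; rewrite (funext (fun y => ipE (f y) (g y))).
have co (h : T -> 'rV[R]_n) i : {for x, continuous h} ->
    {for x, continuous (fun y => h y 0 i)}.
  move=> ch; apply: (@continuous_comp _ _ _ h (fun v : 'rV[R]_n => v 0 i)) => //.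
  exact: coord_continuous.
apply: cvg_big => [|i _]; first exact: add_continuous.
apply: cvg_big => [|j _]; first exact: add_continuous.
apply: cvgM; last exact: cst_continuous.
by apply: cvgM; exact: co.
Qed.

End scalar_product_theory.

(** * Square integrable functions *)

Section L2_theory.
Context {R : realType} (X : manifoldType R) (mu : probability (borel X) R).
Context (n : nat) (ip : 'rV[R]_n -> 'rV[R]_n -> R).
Hypothesis ipS : scalar_product setT ip.
Implicit Types f g h : X -> 'rV[R]_n.
Local Notation L2 := (L2 mu setT ip).
Local Notation dot := (L2dot mu ip).

Lemma ae_mono (P Q : X -> Prop) : (forall x, P x -> Q x) ->
  {ae mu, forall x, P x} -> {ae mu, forall x, Q x}.
Proof. exact: (@filterS _ _ (ae_filter_ringOfSetsType mu)). Qed.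

Lemma ae_and (P Q : X -> Prop) : {ae mu, forall x, P x} -> {ae mu, forall x, Q x} ->
  {ae mu, forall x, P x /\ Q x}.
Proof. by apply: (@filterS2 _ _ (ae_filter_ringOfSetsType mu)) => x p q; split. Qed.

Lemma L2_measurable f : L2 f -> measurable_fun setT (f : borel X -> borel 'rV[R]_n).
Proof. by case. Qed.

Lemma measurable_ip f g :
  measurable_fun setT (f : borel X -> borel 'rV[R]_n) ->
  measurable_fun setT (g : borel X -> borel 'rV[R]_n) ->
  measurable_fun setT ((fun x => ip (f x) (g x)) : borel X -> R).
Proof.
move=> mf mg; under eq_fun do rewrite (ipE ipS).
apply: measurable_sum => i; apply: measurable_sum => j.
apply: measurable_funM; last exact: measurable_cst.
by apply: measurable_funM; exact: measurable_coord.
Qed.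

Lemma measurable_lincomb f g (a : R) :
  measurable_fun setT (f : borel X -> borel 'rV[R]_n) ->
  measurable_fun setT (g : borel X -> borel 'rV[R]_n) ->
  measurable_fun setT ((fun x => a *: f x + g x) : borel X -> borel 'rV[R]_n).
Proof.
move=> mf mg; apply: measurable_rV => i.
under eq_fun do rewrite mxE mxE.
apply: measurable_funD; last exact: measurable_coord.
by apply: measurable_funM; [exact: measurable_cst|exact: measurable_coord].
Qed.

Lemma integrable_sq f : L2 f -> mu.-integrable setT (EFin \o (fun x => ip (f x) (f x))).
Proof.
move=> [_ mf fi]; apply/integrableP; split.
  by apply/measurable_EFinP; exact: measurable_ip.
move: fi; congr (_ < _)%E; apply: eq_integral => x _ /=.
by rewrite ger0_norm ?(ip_ge0 ipS).
Qed.

(** By positivity of the scalar product, integrability and finiteness of the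
    integral coincide. *)
Lemma L2P f : measurable_fun setT (f : borel X -> borel 'rV[R]_n) ->
  mu.-integrable setT (EFin \o (fun x => ip (f x) (f x))) -> L2 f.
Proof.
move=> mf /integrableP[_ fi]; split => //.
move: fi; congr (_ < _)%E; apply: eq_integral => x _ /=.
by rewrite ger0_norm ?(ip_ge0 ipS).
Qed.

Lemma integrable_ip f g : L2 f -> L2 g ->
  mu.-integrable setT (EFin \o (fun x => ip (f x) (g x))).
Proof.
move=> Lf Lg; have := integrableD measurableT (integrable_sq Lf) (integrable_sq Lg).
apply: le_integrable => //.
  by apply/measurable_EFinP; apply: measurable_ip; exact: L2_measurable.
move=> x _; rewrite /= lee_fin (le_trans (ip_young ipS _ _)) // ler_norm //.
Qed.

Lemma L2_dominated f g (C : R) :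
  measurable_fun setT (f : borel X -> borel 'rV[R]_n) -> L2 g ->
  (forall x, ip (f x) (f x) <= C * ip (g x) (g x)) -> L2 f.
Proof.
move=> mf Lg fg; apply: L2P => //.
have := integrableZl measurableT C (integrable_sq Lg).
apply: le_integrable => //; first by apply/measurable_EFinP; exact: measurable_ip.
move=> x _; rewrite /= lee_fin ger0_norm ?(ip_ge0 ipS) //.
by rewrite (le_trans (fg x)) // ler_norm.
Qed.

Lemma L2_lincomb f g (a : R) : L2 f -> L2 g -> L2 (fun x => a *: f x + g x).
Proof.
move=> Lf Lg; apply: L2P.
  by apply: measurable_lincomb; exact: L2_measurable.
have := integrableD measurableT (integrableZl measurableT (2 * a ^+ 2) (integrable_sq Lf))
  (integrableZl measurableT 2 (integrable_sq Lg)).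
apply: le_integrable => //.
  apply/measurable_EFinP; apply: measurable_ip;
  by apply: measurable_lincomb; exact: L2_measurable.
move=> x _; rewrite /= lee_fin ger0_norm ?(ip_ge0 ipS) //.
rewrite (le_trans (ip_sqD ipS _ _)) // !(ipZl ipS, ipZr ipS).
apply: le_trans (ler_norm _); rewrite le_eqVlt; apply/orP; left.
by apply/eqP; ring.
Qed.

Lemma L2_0 : L2 (cst 0).
Proof.
split => //.
by under eq_integral do rewrite (ip0l ipS); rewrite integral0 ltry.
Qed.

Lemma L2B f g : L2 f -> L2 g -> L2 (f \- g).
Proof.
move=> Lf Lg; have := L2_lincomb (-1) Lg Lf; congr L2.
by rewrite funeqE => x /=; rewrite scaleN1r addrC.
Qed.

Lemma L2D f g : L2 f -> L2 g -> L2 (f \+ g).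
Proof.
move=> Lf Lg; have := L2_lincomb 1 Lf Lg; congr L2.
by rewrite funeqE => x /=; rewrite scale1r.
Qed.

Lemma L2dot_lincomb f g h (a : R) : L2 f -> L2 g -> L2 h ->
  dot (fun x => a *: f x + g x) h = a * dot f h + dot g h.
Proof.
move=> Lf Lg Lh; rewrite /L2dot -RintegralZl //; last exact: integrable_ip.
rewrite -RintegralD //; [|by apply: (integrableZl measurableT a (integrable_ip Lf Lh))
                         |exact: integrable_ip].
by apply: eq_Rintegral => x _; rewrite (ipDl ipS) (ipZl ipS).
Qed.

Lemma L2dotDl f g h : L2 f -> L2 g -> L2 h ->
  dot (f \+ g) h = dot f h + dot g h.
Proof.
move=> Lf Lg Lh; rewrite -[in RHS](mul1r (dot f h)) -L2dot_lincomb //.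
by congr (L2dot _ _ _ _); rewrite funeqE => x /=; rewrite scale1r.
Qed.

Lemma L2dotBl f g h : L2 f -> L2 g -> L2 h ->
  dot (f \- g) h = dot f h - dot g h.
Proof.
move=> Lf Lg Lh; rewrite addrC -mulN1r -L2dot_lincomb //.
by congr (L2dot _ _ _ _); rewrite funeqE => x /=; rewrite scaleN1r addrC.
Qed.

Lemma L2dot_ge0 f : 0 <= dot f f.
Proof. by apply: Rintegral_ge0 => x _; exact: (ip_ge0 ipS). Qed.

Lemma L2dot_eq0 f : L2 f -> dot f f = 0 -> {ae mu, forall x, f x = 0}.
Proof.
move=> Lf ff0.
have /integrableP[mi _] := integrable_sq Lf.
have : ae_eq mu setT (EFin \o (fun x => ip (f x) (f x))) (cst 0%E).
  apply/(ae_eq_integral_abs mu measurableT mi).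
  have -> : (\int[mu]_x `|(EFin \o (fun x => ip (f x) (f x))) x| =
      \int[mu]_x (ip (f x) (f x))%:E)%E.
    by apply: eq_integral => x _; rewrite /= ger0_norm ?(ip_ge0 ipS).
  have fi := integrable_fin_num measurableT (integrable_sq Lf).
  by rewrite -[LHS]fineK //; move: ff0; rewrite /L2dot /Rintegral => ->.
by apply: filterS => x /(_ I) [] /(ip_eq0 ipS).
Qed.

End L2_theory.

(** * Invariant functions and projections onto them *)

Section invariant_functions.
Context {R : realType} (X : manifoldType R) (mu : probability (borel X) R).
Context (F : R -> X -> X).
Hypothesis F1m : measurable_fun setT (F 1 : borel X -> borel X).
Hypothesis F1mu : forall A : set (borel X), measurable A -> mu (F 1 @^-1` A) = mu A.
Context (n : nat) (ip : 'rV[R]_n -> 'rV[R]_n -> R).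
Hypothesis ipS : scalar_product setT ip.
Local Notation L2 := (L2 mu setT ip).
Local Notation dot := (L2dot mu ip).

(** F_1 preserves the measure, so the preimage of a null set is null. *)
Lemma ae_shift (P : X -> Prop) :
  {ae mu, forall x, P x} -> {ae mu, forall x, P (F 1 x)}.
Proof.
move=> [A [mA A0 PA]]; exists (F 1 @^-1` A); split.
- by rewrite -[X in measurable X]setTI; exact: F1m.
- by rewrite F1mu.
- by move=> x /= nP; apply: PA.
Qed.

Lemma ge0_integral_shift (f : X -> \bar R) :
  measurable_fun setT (f : borel X -> \bar R) -> (forall x, (0 <= f x)%E) ->
  (\int[mu]_x f (F 1 x) = \int[mu]_x f x)%E.
Proof.
move=> mf f0.
rewrite -[LHS](@ge0_integral_pushforward _ _ (borel X) (borel X) _ _ F1m mu setT f) //.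
by apply: eq_measure_integral => A mA _; exact: F1mu.
Qed.

(** The positive and negative parts are treated separately, so that the formula
    also holds when f is not integrable. *)
Lemma integral_shift (f : X -> R) : measurable_fun setT (f : borel X -> R) ->
  (\int[mu]_x (f (F 1 x))%:E = \int[mu]_x (f x)%:E)%E.
Proof.
move=> mf; rewrite [LHS]integralE [RHS]integralE.
have mE : measurable_fun setT (EFin \o f : borel X -> \bar R) by exact/measurable_EFinP.
congr (_ - _)%E.
  rewrite -[RHS](ge0_integral_shift (measurable_funepos mE) (funepos_ge0 _)).
  by apply: eq_integral => x _; rewrite !funeposE.
rewrite -[RHS](ge0_integral_shift (measurable_funeneg mE) (funeneg_ge0 _)).
by apply: eq_integral => x _; rewrite !funenegE.
Qed.

Section kernel.
Variable U : X -> 'rV[R]_n -> 'rV[R]_n.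
Hypothesis Ulin : forall x, linear (U x).
Hypothesis Uip : forall x u v, ip (U x u) (U x v) = ip u v.
Local Notation K := (in_ker_1W mu F setT ip U).
Local Notation W := (W_op F U).
Local Notation proj := (is_ker_proj mu F setT ip U).

Lemma ker_lincomb a q1 q2 : K q1 -> K q2 -> K (fun x => a *: q1 x + q2 x).
Proof.
move=> [L1 k1] [L2' k2]; split; first exact: L2_lincomb.
apply: ae_mono (ae_and k1 k2) => x; rewrite /W_op => -[e1 e2].
by rewrite Ulin e1 e2.
Qed.

Lemma ker_0 : K (cst 0).
Proof.
split; first exact: L2_0.
apply: (@ae_mono _ _ _ setT) => [x _|]; last by apply: aeW.
by rewrite /W_op /= (linear_fun0 (Ulin x)).
Qed.

Lemma kerB q1 q2 : K q1 -> K q2 -> K (q1 \- q2).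
Proof.
move=> k1 k2; have := ker_lincomb (-1) k2 k1; congr in_ker_1W.
by rewrite funeqE => x /=; rewrite scaleN1r addrC.
Qed.

(** The difference of two projections is invariant and orthogonal to the
    invariant functions, hence orthogonal to itself. *)
Lemma ker_proj_unique f p1 p2 : L2 f -> proj f p1 -> proj f p2 ->
  {ae mu, forall x, p1 x = p2 x}.
Proof.
move=> Lf [k1 o1] [k2 o2].
have k := kerB k1 k2; have [L1 _] := k1; have [L2' _] := k2.
have L12 := L2B ipS L1 L2'.
have := o1 _ k; have := o2 _ k.
rewrite !(L2dotBl ipS) // => e2 e1.
have e0 : dot (p1 \- p2) (p1 \- p2) = 0 by rewrite (L2dotBl ipS) //; lra.
apply: ae_mono (L2dot_eq0 ipS L12 e0) => x /= /eqP.
by rewrite subr_eq0 => /eqP.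
Qed.

(** q = W q almost everywhere, and W is isometric: <W g, q> = <W g, W q> =
    <g, q>.  In other words (1 - W) g is orthogonal to the kernel of 1 - W. *)
Lemma dot_W_ker g q : L2 g -> L2 (W g) -> K q -> dot (W g) q = dot g q.
Proof.
move=> Lg LWg [Lq kq].
have mgq : measurable_fun setT ((fun x => ip (g x) (q x)) : borel X -> R).
  by apply: (measurable_ip ipS); [case: Lg|case: Lq].
rewrite /L2dot /Rintegral -(integral_shift mgq); congr fine.
apply: ae_eq_integral => //.
- exact: (measurable_int mu (integrable_ip ipS LWg Lq)).
- by apply/measurable_EFinP; exact: (measurableT_comp mgq F1m).
- apply: (ae_mono _ kq) => x; rewrite /W_op => <- _.
  by rewrite Uip.
Qed.

End kernel.

(** A conjugates W to W' and is isometric, with inverse B; this transports the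
    projection of f to that of A f.  By the hypothesis relating f' and f, the
    function f' differs from A f by (1 - W') g, which projects to 0. *)
Lemma ker_proj_intertwine (U U' A B : X -> 'rV[R]_n -> 'rV[R]_n) f p g f' :
  (forall x, linear (U x)) -> (forall x, linear (U' x)) ->
  (forall x, linear (A x)) -> (forall x, linear (B x)) ->
  (forall x u v, ip (U' x u) (U' x v) = ip u v) ->
  (forall x u v, ip (A x u) (A x v) = ip u v) ->
  (forall x u, A x (B x u) = u) -> (forall x u, B x (A x u) = u) ->
  (forall v, measurable_fun setT ((fun x => A x v) : borel X -> borel 'rV[R]_n)) ->
  (forall v, measurable_fun setT ((fun x => B x v) : borel X -> borel 'rV[R]_n)) ->
  (forall x u, U' x (A (F 1 x) u) = A x (U x u)) ->
  L2 f -> L2 f' -> L2 g ->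
  (forall x, f' x + U' x (g (F 1 x)) = g x + A x (f x)) ->
  is_ker_proj mu F setT ip U f p ->
  is_ker_proj mu F setT ip U' f' (fun x => A x (p x)).
Proof.
move=> Ulin U'lin Alin Blin U'ip Aip AB BA mA mB int Lf Lf' Lg ff' [kp op].
have LA h : L2 h -> L2 (fun x => A x (h x)).
  move=> Lh; apply: (L2_dominated ipS (C := 1) _ Lh).
    by apply: measurable_linear_family => //; case: Lh.
  by move=> x; rewrite Aip mul1r.
have Bip x u v : ip (B x u) (B x v) = ip u v by rewrite -(Aip x) !AB.
have LB h : L2 h -> L2 (fun x => B x (h x)).
  move=> Lh; apply: (L2_dominated ipS (C := 1) _ Lh).
    by apply: measurable_linear_family => //; case: Lh.
  by move=> x; rewrite Bip mul1r.
have [Lp Wp] := kp.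
split.
  split; first exact: LA.
  by apply: ae_mono Wp => x; rewrite /W_op int => ->.
move=> q [Lq Wq].
have kBq : in_ker_1W mu F setT ip U (fun x => B x (q x)).
  split; first exact: LB.
  apply: ae_mono Wq => x; rewrite /W_op => Wq.
  by rewrite -[LHS](BA x) -int AB Wq.
have LWg : L2 (W_op F U' g).
  have := L2B ipS (L2D ipS Lg (LA _ Lf)) Lf'.
  by congr (Defs.L2 _ _ _ _); rewrite funeqE => x /=; rewrite -ff' addrC addKr.
have E : f' \- (fun x => A x (p x)) =
    (g \- W_op F U' g) \+ (fun x => A x (f x - p x)).
  rewrite funeqE => x /=; have -> : f' x = g x + A x (f x) - U' x (g (F 1 x)).
    by rewrite -ff' addrK.
  rewrite (linear_funB (Alin x)).
  by rewrite /W_op -!addrA; congr (_ + _); rewrite addrCA.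
have LAfp : L2 (fun x => A x (f x - p x)) by apply: LA; exact: L2B.
rewrite E (L2dotDl ipS) //; last exact: L2B.
rewrite (L2dotBl ipS) // (dot_W_ker U'ip) // subrr add0r.
have := op _ kBq; rewrite /L2dot => <-.
by apply: eq_Rintegral => x _ /=; rewrite -[in RHS](Aip x) AB.
Qed.

End invariant_functions.

(** * Adjoints, and projections under intertwining linear maps *)

Section adjoints.
Context {R : realType} (n : nat) (ip : 'rV[R]_n -> 'rV[R]_n -> R).
Hypothesis ipS : scalar_product setT ip.

(** The vector which represents the linear form with coefficients b: the
    transposed inverse of the Gram matrix applied to b. *)
Definition riesz (b : 'rV[R]_n) : 'rV[R]_n :=
  b *m (invmx (\matrix_(i, j) ip (delta_mx 0 i) (delta_mx 0 j)))^T.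

Lemma rieszP b v : ip v (riesz b) = \sum_i v 0 i * b 0 i.
Proof.
set A := \matrix_(i, j) ip (delta_mx 0 i) (delta_mx 0 j).
have E u w : ip u w = (u *m A *m w^T) 0 0.
  rewrite (ipE ipS) exchange_big mxE /=; apply: eq_bigr => j _.
  rewrite !mxE mulr_suml; apply: eq_bigr => i _.
  by rewrite mxE mulrAC.
rewrite E /riesz trmx_mul trmxK mulmxA mulmxK ?(ip_gram_unit ipS) //.
by rewrite mxE; apply: eq_bigr => i _; rewrite mxE.
Qed.

Lemma ip_CauchySchwarz u v : ip u v ^+ 2 <= ip u u * ip v v.
Proof.
have [->|v0] := eqVneq v 0.
  by rewrite (ipC ipS) !(ip0l ipS) expr0n mulr0.
have vv : 0 < ip v v by case: ipS => _ _; apply.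
have := ip_ge0 ipS (ip v v *: u - ip u v *: v).
rewrite !(ipBl ipS, ipBr ipS, ipZl ipS, ipZr ipS) (ipC ipS v u) => h.
rewrite -subr_ge0 -(pmulr_rge0 _ vv); apply: le_trans h _.
by rewrite le_eqVlt; apply/orP; left; apply/eqP; ring.
Qed.

(** Each coordinate is the scalar product with a fixed vector. *)
Lemma coord_bound : exists2 C : R, 0 <= C &
  forall (u : 'rV[R]_n) i, (u 0 i) ^+ 2 <= C * ip u u.
Proof.
exists (\sum_i ip (riesz (delta_mx 0 i)) (riesz (delta_mx 0 i))).
  by apply: sumr_ge0 => i _; exact: ip_ge0.
move=> u i.
have -> : u 0 i = ip u (riesz (delta_mx 0 i)).
  rewrite rieszP (bigD1 i) //= mxE !eqxx mulr1 big1 ?addr0 // => j ji.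
  by rewrite mxE (negbTE ji) andbF mulr0.
apply: (le_trans (ip_CauchySchwarz _ _)); rewrite mulrC.
apply: ler_wpM2r; first exact: ip_ge0.
by rewrite (bigD1 i) //= lerDl; apply: sumr_ge0 => j _; exact: ip_ge0.
Qed.

Lemma form_bound (b : 'I_n -> 'I_n -> R) :
  exists C : R, forall u : 'rV[R]_n,
    \sum_i \sum_j u 0 i * u 0 j * b i j <= C * ip u u.
Proof.
have [C C0 hC] := coord_bound.
exists (\sum_i \sum_j `|b i j| * (2 * C)).
move=> u; rewrite mulr_suml; apply: ler_sum => i _.
rewrite mulr_suml; apply: ler_sum => j _.
have h : `|u 0 i * u 0 j| <= 2 * C * ip u u.
  have h1 := hC u i; have h2 := hC u j.
  have := sqr_ge0 (u 0 i - u 0 j); have := sqr_ge0 (u 0 i + u 0 j).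
  have := mulr_ge0 C0 (ip_ge0 ipS u).
  move: h1 h2; move: (C * ip u u) (mulrA 2 C (ip u u)) => z <- h1 h2 z0 p m.
  rewrite ler_norml; apply/andP; split; nra.
apply: le_trans (ler_norm _) _; rewrite normrM mulrC -mulrA.
by apply: ler_wpM2l.
Qed.

End adjoints.

Section homomorphisms.
Context {R : realType} (X : manifoldType R) (mu : probability (borel X) R).
Context (F : R -> X -> X).
Context (m n : nat) (ip' : 'rV[R]_m -> 'rV[R]_m -> R) (ip : 'rV[R]_n -> 'rV[R]_n -> R).
Hypothesis ipS' : scalar_product setT ip'.
Hypothesis ipS : scalar_product setT ip.
Context (U' : X -> 'rV[R]_m -> 'rV[R]_m) (U : X -> 'rV[R]_n -> 'rV[R]_n).
Hypothesis U'ip : forall x u v, ip' (U' x u) (U' x v) = ip' u v.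
Hypothesis U'surj : forall x u, exists v, U' x v = u.
Hypothesis Uip : forall x u v, ip (U x u) (U x v) = ip u v.
Context (T : 'rV[R]_m -> 'rV[R]_n).
Hypothesis Tlin : linear T.
Hypothesis TU : forall x u, T (U' x u) = U x (T u).

(** The adjoint of T for ip' and ip. *)
Definition adjoint (q : 'rV[R]_n) : 'rV[R]_m :=
  riesz ip' (\row_i ip (T (delta_mx 0 i)) q).

Lemma adjointP u q : ip' u (adjoint q) = ip (T u) q.
Proof.
rewrite rieszP // (linear_fun_rV u Tlin).
by rewrite (ip_suml ipS); apply: eq_bigr => i _; rewrite mxE (ipZl ipS).
Qed.

Lemma adjoint_linear : linear adjoint.
Proof.
move=> a u v; rewrite /adjoint /riesz scalemxAl -mulmxDl; congr (_ *m _).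
by apply/rowP => i; rewrite !mxE (ipDr ipS) (ipZr ipS).
Qed.

Lemma ip_ext u v : (forall w, ip' w u = ip' w v) -> u = v.
Proof.
move=> h; apply/eqP; rewrite -subr_eq0; apply/eqP/(ip_eq0 ipS').
by rewrite (ipBr ipS') h subrr.
Qed.

(** U' is orthogonal and onto, so it suffices to pair both sides with vectors
    U' v, and there T U' = U T applies. *)
Lemma adjoint_U x q : U' x (adjoint q) = adjoint (U x q).
Proof.
apply: ip_ext => w; have [v <-] := U'surj x w.
by rewrite U'ip !adjointP TU Uip.
Qed.

Lemma hom_bound : exists2 C : R, 0 <= C & forall u, ip (T u) (T u) <= C * ip' u u.
Proof.
have [C hC] := form_bound ipS' (fun i j => ip (T (delta_mx 0 i)) (T (delta_mx 0 j))).
exists (Num.max C 0) => [|u]; first by rewrite le_max lexx orbT.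
apply: (@le_trans _ _ (C * ip' u u)); last first.
  by apply: ler_wpM2r; [exact: ip_ge0|rewrite le_max lexx].
apply: le_trans (hC u).
rewrite {1}(linear_fun_rV u Tlin) (ip_suml ipS) le_eqVlt; apply/orP; left; apply/eqP.
apply: eq_bigr => i _; rewrite (ipZl ipS) (linear_fun_rV u Tlin) (ip_sumr ipS) mulr_sumr.
by apply: eq_bigr => j _; rewrite (ipZr ipS) mulrA.
Qed.

(** By the Cauchy-Schwarz inequality, |T* q|^2 = <T T* q, q> is at most
    |T T* q| |q|, hence at most the bound of T times |T* q| |q|. *)
Lemma adjoint_bound : exists C : R, forall q, ip' (adjoint q) (adjoint q) <= C * ip q q.
Proof.
have [C C0 hC] := hom_bound; exists C => q.
set a := adjoint q.
have aa := ip_ge0 ipS' a; have qq := ip_ge0 ipS q.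
have h1 := ip_CauchySchwarz ipS (T a) q.
rewrite -adjointP -/a in h1.
have h2 := hC a.
have {h1 h2} h : ip' a a ^+ 2 <= ip' a a * (C * ip q q).
  apply: (le_trans h1); rewrite mulrA; apply: ler_wpM2r => //.
  by rewrite [X in _ <= X]mulrC.
have [a0|a0] := eqVneq (ip' a a) 0; last first.
  by rewrite -(ler_pM2l (_ : 0 < ip' a a)) ?lt_def ?a0 // -expr2.
by rewrite a0 mulr_ge0.
Qed.

Lemma L2_hom h : Defs.L2 mu setT ip' h -> Defs.L2 mu setT ip (T \o h).
Proof.
move=> Lh; have [C _ hC] := hom_bound.
have mT : measurable_fun setT ((T \o h) : borel X -> borel 'rV[R]_n).
  apply: (measurable_linear_family (A := fun=> T)) => //.
  by case: Lh.
apply: L2P => //.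
have := integrableZl measurableT C (integrable_sq ipS' Lh).
apply: le_integrable => //; first by apply/measurable_EFinP; exact: measurable_ip.
move=> x _; rewrite /= lee_fin ger0_norm ?(ip_ge0 ipS) //.
by rewrite (le_trans (hC _)) // ler_norm.
Qed.

(** <T f - T p, q> = <f - p, T* q>, and T* q is invariant along with q. *)
Lemma ker_proj_hom f p : Defs.L2 mu setT ip' f -> is_ker_proj mu F setT ip' U' f p ->
  is_ker_proj mu F setT ip U (T \o f) (T \o p).
Proof.
move=> Lf [[Lp kp] op].
split.
  split; first exact: L2_hom.
  by apply: ae_mono kp => x; rewrite /W_op /= -TU => ->.
move=> q [Lq kq].
have ka : in_ker_1W mu F setT ip' U' (adjoint \o q).
  split.
    have [C hC] := adjoint_bound.
    have mA : measurable_fun setT ((adjoint \o q) : borel X -> borel 'rV[R]_m).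
      apply: (measurable_linear_family (A := fun=> adjoint)) => //.
        by move=> _; exact: adjoint_linear.
      by case: Lq.
    apply: L2P => //.
    have := integrableZl measurableT C (integrable_sq ipS Lq).
    apply: le_integrable => //; first by apply/measurable_EFinP; exact: measurable_ip.
    move=> x _; rewrite /= lee_fin ger0_norm ?(ip_ge0 ipS') //.
    by rewrite (le_trans (hC _)) // ler_norm.
  by apply: ae_mono kq => x; rewrite /W_op /= adjoint_U => ->.
have := op _ ka; rewrite /L2dot => <-.
apply: eq_Rintegral => x _ /=; rewrite adjointP; congr (ip _ _).
by rewrite (linear_funB Tlin).
Qed.

End homomorphisms.

(** * Existence of the projection *)

Section Riesz_Fischer.
Context {R : realType} (X : manifoldType R) (mu : probability (borel X) R).
Context (n : nat) (ip : 'rV[R]_n -> 'rV[R]_n -> R).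
Hypothesis ipS : scalar_product setT ip.
Local Notation L2 := (L2 mu setT ip).
Local Notation dot := (L2dot mu ip).

Lemma EFin_dot f g : L2 f -> L2 g ->
  (\int[mu]_x (ip (f x) (g x))%:E = (dot f g)%:E)%E.
Proof.
move=> Lf Lg; rewrite /L2dot /Rintegral fineK //.
exact: (integrable_fin_num measurableT (integrable_ip ipS Lf Lg)).
Qed.

(** Makes square summability with weights 2^k yield absolute summability:
    |a| is at most (w a^2 + 1 / w) / 2. *)
Lemma norm_le_weighted_sq (w a z C : R) : 0 < w -> a ^+ 2 <= C * z ->
  `|a| <= 1 / 2 * w^-1 + C * (w * z).
Proof.
move=> w0 az.
have wz : w * a ^+ 2 <= C * (w * z) by rewrite [X in _ <= X]mulrCA ler_pM2l.
have wV : 0 <= w^-1 by rewrite invr_ge0 ltW.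
have s1 : 0 <= w^-1 * (w * a - 1) ^+ 2 by rewrite mulr_ge0 ?sqr_ge0.
have s2 : 0 <= w^-1 * (w * a + 1) ^+ 2 by rewrite mulr_ge0 ?sqr_ge0.
have e1 : w^-1 * (w * a - 1) ^+ 2 = w * a ^+ 2 - 2 * a + w^-1.
  by field; rewrite gt_eqF.
have e2 : w^-1 * (w * a + 1) ^+ 2 = w * a ^+ 2 + 2 * a + w^-1.
  by field; rewrite gt_eqF.
rewrite e1 in s1; rewrite e2 in s2.
have wa : 0 <= w * a ^+ 2 by rewrite mulr_ge0 ?sqr_ge0 // ltW.
by rewrite ler_norml; apply/andP; split; lra.
Qed.

(** The almost everywhere convergence in the Riesz-Fischer theorem.  The series
    of the 2^k |q_(k+1) - q_k|^2 has a finite integral, so it converges almost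
    everywhere, and then so does the series of the increments of each
    coordinate. *)
Lemma ae_cvg_of_fast_cauchy (q : nat -> X -> 'rV[R]_n) :
  (forall k, L2 (q k)) ->
  (forall k, (2 ^ k)%:R * dot (q k.+1 \- q k) (q k.+1 \- q k) <= (2 ^ k.+1)%:R^-1) ->
  exists2 p : X -> 'rV[R]_n,
    measurable_fun setT (p : borel X -> borel 'rV[R]_n) &
    {ae mu, forall x, forall i, q k x 0 i @[k --> \oo] --> p x 0 i}.
Proof.
move=> Lq fast.
pose delta k := q k.+1 \- q k.
have Ld k : L2 (delta k) by exact: L2B.
pose g k x := (2 ^ k)%:R * ip (delta k x) (delta k x).
have g0 k x : 0 <= g k x by rewrite mulr_ge0 // ip_ge0.
have mg k : measurable_fun setT ((fun x => (g k x)%:E) : borel X -> \bar R).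
  apply/measurable_EFinP; apply: measurable_funM; first exact: measurable_cst.
  by apply: measurable_ip => //; exact: L2_measurable.
pose G x : \bar R := (\sum_(k <oo) (g k x)%:E)%E.
have mG : measurable_fun setT (G : borel X -> \bar R).
  by apply: ge0_emeasurable_sum => // k x _ _; rewrite lee_fin.
have Gi : mu.-integrable setT G.
  apply/integrableP; split => //.
  have -> : (\int[mu]_x `|G x| = \int[mu]_x G x)%E.
    apply: eq_integral => x _; rewrite gee0_abs //.
    by apply: nneseries_ge0 => k _ _; rewrite lee_fin.
  rewrite integral_nneseries //; last by move=> k x _; rewrite lee_fin.
  apply: (@le_lt_trans _ _ 1%:E); last exact: ltry.
  apply: (le_trans _ (@epsilon_trick0 R 1 xpredT ler01)).
  apply: lee_nneseries => [k _ _|k _].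
    by apply: integral_ge0 => x _; rewrite lee_fin.
  rewrite /g; under eq_integral do rewrite EFinM.
  rewrite ge0_integralZl //; last by move=> x _; rewrite lee_fin ip_ge0.
    by rewrite (EFin_dot (Ld k) (Ld k)) -EFinM lee_fin div1r; exact: fast.
  by apply/measurable_EFinP; apply: measurable_ip => //; exact: L2_measurable.
(* The upper limit is measurable without any convergence hypothesis; where it
   is infinite, [fine] returns 0. *)
pose p x : 'rV[R]_n := \row_i fine (limn_esup (fun k => (q k x 0 i)%:E)).
exists p.
  apply: measurable_rV => i.
  under eq_fun do rewrite mxE.
  apply: (@measurableT_comp _ _ _ _ _ _ (@fine R)) => //.
  apply: measurable_fun_limn_esup => k; apply/measurable_EFinP.
  by apply: measurable_coord; exact: L2_measurable.
have := integrable_ae measurableT Gi; apply: (ae_mono) => x /(_ I) Gfin i.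
have [C C0 hC] := coord_bound ipS.
have cg : cvgn (series (fun k => g k x)).
  by apply: nnseries_is_cvg => //; rewrite -/(G x) ltey_eq Gfin.
have cd : cvgn (series (fun k => delta k x 0 i)).
  apply: normed_cvg.
  apply: (@series_le_cvg _ _ (fun k => 1 / 2 * (2^-1) ^+ k + C * g k x)).
  - by move=> k; exact: normr_ge0.
  - move=> k; apply: addr_ge0; last exact: mulr_ge0.
    by apply: mulr_ge0; [rewrite divr_ge0|rewrite exprn_ge0 // invr_ge0].
  - move=> k; have := hC (delta k x) i.
    have w0 : (0 : R) < (2 ^ k)%:R by rewrite ltr0n expn_gt0.
    have -> : (2^-1) ^+ k = ((2 ^ k)%:R)^-1 :> R by rewrite exprVn natrX.
    exact: norm_le_weighted_sq.
  - have -> : (fun k => 1 / 2 * (2^-1) ^+ k + C * g k x) =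
       geometric (1 / 2) (2^-1) + C *: (fun k => g k x) by [].
    apply: is_cvg_seriesD; last exact: is_cvg_seriesZ.
    by apply: is_cvg_geometric_series; rewrite ger0_norm // invf_lt1 // ltr1n.
have cq : cvgn (fun k => q k x 0 i).
  rewrite (_ : (fun k => _) = (fun k => q 0%N x 0 i + series (fun k => delta k x 0 i) k)).
    by apply: is_cvgD => //; exact: is_cvg_cst.
  rewrite funeqE => k; rewrite [LHS](eq_sum_telescope (fun k => q k x 0 i)).
  congr (_ + _); rewrite /series /=; apply: eq_bigr => j _.
  by rewrite /telescope /delta !mxE.
rewrite mxE.
have cE : (q k x 0 i)%:E @[k --> \oo] --> (limn (fun k => q k x 0 i))%:E.
  by apply: cvg_EFin => //; exact: nearW.
by have [_ ->] := cvg_limn_einf_sup cE.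
Qed.

End Riesz_Fischer.

Section projection_exists.
Context {R : realType} (X : manifoldType R) (mu : probability (borel X) R).
Context (F : R -> X -> X).
Hypothesis F1m : measurable_fun setT (F 1 : borel X -> borel X).
Hypothesis F1mu : forall A : set (borel X), measurable A -> mu (F 1 @^-1` A) = mu A.
Context (n : nat) (ip : 'rV[R]_n -> 'rV[R]_n -> R).
Hypothesis ipS : scalar_product setT ip.
Context (U : X -> 'rV[R]_n -> 'rV[R]_n).
Hypothesis Ulin : forall x, linear (U x).
Local Notation L2 := (L2 mu setT ip).
Local Notation dot := (L2dot mu ip).
Local Notation K := (in_ker_1W mu F setT ip U).

Lemma dot_comb2 f g (a b : R) : L2 f -> L2 g ->
  dot (fun x => a *: f x + b *: g x) (fun x => a *: f x + b *: g x) =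
  a ^+ 2 * dot f f + 2 * a * b * dot f g + b ^+ 2 * dot g g.
Proof.
move=> Lf Lg.
have iff := integrable_ip ipS Lf Lf; have ifg := integrable_ip ipS Lf Lg.
have igg := integrable_ip ipS Lg Lg.
have h1 : mu.-integrable setT (EFin \o (fun x => a ^+ 2 * ip (f x) (f x))).
  exact: (integrableZl measurableT (a ^+ 2) iff).
have h2 : mu.-integrable setT (EFin \o (fun x => 2 * a * b * ip (f x) (g x))).
  exact: (integrableZl measurableT (2 * a * b) ifg).
have h3 : mu.-integrable setT (EFin \o (fun x => b ^+ 2 * ip (g x) (g x))).
  exact: (integrableZl measurableT (b ^+ 2) igg).
have h12 : mu.-integrable setT (EFin \o (fun x =>
    a ^+ 2 * ip (f x) (f x) + 2 * a * b * ip (f x) (g x))).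
  exact: (integrableD measurableT h1 h2).
rewrite /L2dot -!RintegralZl // -!RintegralD //.
apply: eq_Rintegral => x _.
by rewrite !(ipDl ipS, ipDr ipS, ipZl ipS, ipZr ipS) (ipC ipS (g x) (f x)); ring.
Qed.

Lemma cvg_ip (u v : nat -> 'rV[R]_n) (u0 v0 : 'rV[R]_n) :
  (forall i, u k 0 i @[k --> \oo] --> u0 0 i) ->
  (forall i, v k 0 i @[k --> \oo] --> v0 0 i) ->
  ip (u k) (v k) @[k --> \oo] --> ip u0 v0.
Proof.
move=> cu cv; rewrite (ipE ipS).
under eq_fun do rewrite (ipE ipS).
apply: cvg_big => [|i _]; first exact: add_continuous.
apply: cvg_big => [|j _]; first exact: add_continuous.
by apply: cvgM; [apply: cvgM|exact: cvg_cst].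
Qed.

Lemma cvg_linear_rV (T : 'rV[R]_n -> 'rV[R]_n) (u : nat -> 'rV[R]_n) (u0 : 'rV[R]_n) j :
  linear T -> (forall i, u k 0 i @[k --> \oo] --> u0 0 i) ->
  T (u k) 0 j @[k --> \oo] --> T u0 0 j.
Proof.
move=> Tlin cu.
have TE v : T v 0 j = \sum_i v 0 i * T (delta_mx 0 i) 0 j.
  rewrite (linear_fun_rV v Tlin) summxE.
  by apply: eq_bigr => i _; rewrite mxE.
rewrite TE; under eq_fun do rewrite TE.
apply: cvg_big => [|i _]; first exact: add_continuous.
by apply: cvgM; [exact: cu|exact: cvg_cst].
Qed.

(* Errors for which 2^k |q_(k+1) - q_k|^2 <= 1 / 2^(k+1), the bound asked for by
   [ae_cvg_of_fast_cauchy]. *)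
Let eps k : R := (8 * (2 ^ k)%:R * (2 ^ k)%:R)^-1.

Let eps0 k : 0 < eps k.
Proof. by rewrite invr_gt0 !mulr_gt0 // ltr0n expn_gt0. Qed.

Lemma minimizing_sequence f : L2 f -> exists (q : nat -> X -> 'rV[R]_n) (D : R),
  [/\ forall k, K (q k), forall k, dot (f \- q k) (f \- q k) < D + eps k &
      forall h, K h -> D <= dot (f \- h) (f \- h)].
Proof.
move=> Lf; pose S := [set dot (f \- h) (f \- h) | h in K].
have Si : has_inf S.
  split; first by exists (dot (f \- cst 0) (f \- cst 0)), (cst 0) => //; exact: ker_0.
  by exists 0 => _ [h _ <-]; exact: L2dot_ge0.
have ex k : exists h, K h /\ dot (f \- h) (f \- h) < inf S + eps k.
  by have [_ [h Kh <-] hk] := inf_adherent (eps0 k) Si; exists h.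
have [q hq] := choice ex.
exists q, (inf S); split=> [k|k|h Kh]; [by have [] := hq k|by have [] := hq k|].
by apply: ge_inf; [case: Si|exists h].
Qed.

(** The parallelogram identity for f - h1 and f - h2; the midpoint of h1 and h2
    is invariant, so its squared distance to f is at least D. *)
Lemma minimizers_close f h1 h2 D e1 e2 : L2 f -> K h1 -> K h2 ->
  (forall h, K h -> D <= dot (f \- h) (f \- h)) ->
  dot (f \- h1) (f \- h1) < D + e1 -> dot (f \- h2) (f \- h2) < D + e2 ->
  dot (h2 \- h1) (h2 \- h1) <= 2 * (e1 + e2).
Proof.
move=> Lf k1 k2 Dmin n1 n2.
have [L1 _] := k1; have [L2' _] := k2.
have La := L2B ipS Lf L1; have Lb := L2B ipS Lf L2'.
have km : K (fun x => 2^-1 *: h1 x + (fun x => 2^-1 *: h2 x + cst 0 x) x).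
  apply: (ker_lincomb ipS Ulin) => //.
  by apply: (ker_lincomb ipS Ulin) => //; exact: ker_0.
have := Dmin _ km.
have -> : f \- (fun x => 2^-1 *: h1 x + (fun x => 2^-1 *: h2 x + cst 0 x) x) =
   (fun x => 2^-1 *: (f \- h1) x + 2^-1 *: (f \- h2) x).
  rewrite funeqE => x /=; rewrite addr0 !scalerBr addrACA -scalerDl -opprD.
  have -> : 2^-1 + 2^-1 = 1 :> R by lra.
  by rewrite scale1r.
have -> : h2 \- h1 = (fun x => 1 *: (f \- h1) x + (-1) *: (f \- h2) x).
  rewrite funeqE => x /=; rewrite scale1r scaleN1r opprB [RHS]addrC.
  by rewrite addrA subrK.
rewrite !dot_comb2 //; move: n1 n2.
move: (dot (f \- h1) (f \- h1)) (dot (f \- h2) (f \- h2)) (dot (f \- h1) (f \- h2)).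
by move=> A B C n1 n2 Dm; lra.
Qed.

(** Let p be the almost everywhere limit of a fast minimizing sequence.  Fatou's
    lemma bounds the squared distance from f to p by the infimum D, so p is the
    closest invariant function, and a quadratic variation argument shows that
    f - p is orthogonal to the invariant functions. *)
Lemma ker_proj_exists f : L2 f -> exists p, is_ker_proj mu F setT ip U f p.
Proof.
move=> Lf; have [q [D [Kq nq Dmin]]] := minimizing_sequence Lf.
have Lq k : L2 (q k) by case: (Kq k).
have fast k : (2 ^ k)%:R * dot (q k.+1 \- q k) (q k.+1 \- q k) <= (2 ^ k.+1)%:R^-1.
  have w0 : (0 : R) < (2 ^ k)%:R by rewrite ltr0n expn_gt0.
  have eS : eps k.+1 <= eps k.
    rewrite /eps lef_pV2 ?posrE ?mulr_gt0 ?ltr0n ?expn_gt0 //.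
    have : (2 ^ k)%:R <= (2 ^ k.+1)%:R :> R by rewrite ler_nat leq_exp2l.
    by move=> h; apply: ler_pM => //; apply: ler_pM.
  have := minimizers_close Lf (Kq k) (Kq k.+1) Dmin (nq k) (nq k.+1).
  move=> /(ler_wpM2l (ltW w0)) h; apply: le_trans h _.
  apply: (@le_trans _ _ ((2 ^ k)%:R * (4 * eps k))).
    by apply: ler_wpM2l; [exact: ltW|lra].
  rewrite /eps expnS natrM le_eqVlt; apply/orP; left; apply/eqP.
  by field; rewrite gt_eqF.
have [p mp cqp] := ae_cvg_of_fast_cauchy ipS Lq fast.
have mfp : measurable_fun setT ((f \- p) : borel X -> borel 'rV[R]_n).
  have := measurable_lincomb (-1) mp (L2_measurable Lf).
  by congr measurable_fun; rewrite funeqE => x /=; rewrite scaleN1r addrC.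
pose N k x := (ip ((f \- q k) x) ((f \- q k) x))%:E.
have mN k : measurable_fun setT (N k : borel X -> \bar R).
  apply/measurable_EFinP; apply: measurable_ip => //;
  exact: L2_measurable (L2B ipS Lf (Lq k)).
have N0 k x : (0 <= N k x)%E by rewrite lee_fin ip_ge0.
have Nfp : (\int[mu]_x (ip ((f \- p) x) ((f \- p) x))%:E <= D%:E)%E.
  have mlim : measurable_fun setT ((fun x => limn_einf (N ^~ x)) : borel X -> \bar R).
    under eq_fun do rewrite /limn_einf.
    apply: measurableT_comp => //; apply: measurable_fun_limn_esup => k.
    exact: measurableT_comp.
  have -> : (\int[mu]_x (ip ((f \- p) x) ((f \- p) x))%:E =
             \int[mu]_x limn_einf (N ^~ x))%E.
    apply: ae_eq_integral => //.
      by apply/measurable_EFinP; exact: measurable_ip.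
    apply: (ae_mono _ cqp) => x cx _; apply/esym.
    suff : N k x @[k --> \oo] --> (ip ((f \- p) x) ((f \- p) x))%:E.
      by move=> /cvg_limn_einf_sup[].
    apply: cvg_EFin; first exact: nearW.
    have c i : (f \- q k) x 0 i @[k --> \oo] --> (f \- p) x 0 i.
      rewrite !mxE; under eq_fun do rewrite !mxE.
      by apply: cvgD; [exact: cvg_cst|apply: cvgN; exact: cx].
    exact: (cvg_ip c c).
  apply: le_trans (fatou mu measurableT mN _) _; first by move=> k x _; exact: N0.
  rewrite (_ : (fun k => _) = (fun k => (dot (f \- q k) (f \- q k))%:E)); last first.
    by rewrite funeqE => k; rewrite (EFin_dot ipS) //; exact: L2B.
  have cD : (dot (f \- q k) (f \- q k))%:E @[k --> \oo] --> D%:E.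
    apply: cvg_EFin; first exact: nearW.
    apply: (@squeeze_cvgr _ _ _ _ (cst D) (fun k => D + eps k)).
    - by apply: nearW => k; rewrite (Dmin _ (Kq k)) (ltW (nq k)).
    - exact: cvg_cst.
    - rewrite -[X in _ --> X]addr0; apply: cvgD; first exact: cvg_cst.
      have -> : eps = geometric (8^-1) (4^-1).
        rewrite funeqE => k; rewrite /eps /geometric /= !natrX !invfM.
        by rewrite -mulrA -exprVn -exprMn -invfM -natrM.
      by apply: cvg_geometric; rewrite ger0_norm // invf_lt1 // ltr1n.
  by have [-> _] := cvg_limn_einf_sup cD.
have Lfp : L2 (f \- p).
  by split => //; apply: le_lt_trans Nfp _; exact: ltry.
have Lp : L2 p.
  have := L2B ipS Lf Lfp; congr (Defs.L2 _ _ _ _).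
  by rewrite funeqE => x /=; rewrite opprB addrC subrK.
have Kp : K p.
  split => //.
  have cF := ae_shift F1m F1mu cqp.
  have kk : {ae mu, forall x, forall k, W_op F U (q k) x = q k x}.
    by apply: ae_foralln => k; case: (Kq k).
  apply: ae_mono (ae_and cqp (ae_and cF kk)) => x [cx [cFx kx]].
  apply/rowP => j.
  have c1 := cvg_linear_rV (j := j) (Ulin x) cFx.
  have c2 : U x (q k (F 1 x)) 0 j @[k --> \oo] --> p x 0 j.
    by under eq_fun do rewrite -/(W_op F U (q _) x) kx; exact: cx.
  exact: (cvg_unique _ c1 c2).
exists p; split => // h Kh; have [Lh _] := Kh.
have dD : dot (f \- p) (f \- p) <= D.
  by rewrite -lee_fin -(EFin_dot ipS).
have var t : 0 <= t ^+ 2 * dot h h - 2 * t * dot (f \- p) h.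
  have Kt : K (fun x => t *: h x + p x) by exact: (ker_lincomb ipS Ulin).
  have := Dmin _ Kt.
  have -> : f \- (fun x => t *: h x + p x) = (fun x => 1 *: (f \- p) x + (- t) *: h x).
    by rewrite funeqE => x /=; rewrite scale1r scaleNr opprD addrA addrAC.
  by rewrite dot_comb2 //; lra.
have hh : 0 <= dot h h by exact: L2dot_ge0.
move: (dot h h) (dot (f \- p) h) hh var => a b a0 var.
have a1 : 0 < a + 1 by lra.
(* at this t, the quadratic polynomial t^2 a - 2 t b is negative unless b = 0 *)
have := var (b / (a + 1)).
have -> : (b / (a + 1)) ^+ 2 * a - 2 * (b / (a + 1)) * b =
   - ((b / (a + 1)) ^+ 2 * (a + 2)).
  by field; rewrite gt_eqF.
rewrite oppr_ge0 => h0; apply/eqP; apply: contraT => b0.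
have : 0 < (b / (a + 1)) ^+ 2 * (a + 2).
  apply: mulr_gt0; last by lra.
  by rewrite exprn_even_gt0 //= mulf_neq0 // invr_neq0 // gt_eqF.
by rewrite ltNge h0.
Qed.

Lemma ker_projP f : L2 f -> is_ker_proj mu F setT ip U f (ker_proj mu F setT ip U f).
Proof. by move=> /ker_proj_exists ex; exact: (xgetPex (cst 0) ex). Qed.

End projection_exists.

(** * Coordinates on a subspace of matrices *)

Section coordinates.
Context {R : realType}.

(** Take a subspace of largest dimension among those contained in S: adding a
    vector of S to it cannot increase its dimension. *)
Lemma subspace_vspace (V : vectType R) (S : set V) : S 0 ->
  (forall u v, S u -> S v -> S (u + v)) -> (forall a u, S u -> S (a *: u)) ->
  exists U : {vspace V}, forall v, v \in U <-> S v.
Proof.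
move=> S0 SD SZ.
pose P m := `[< exists U : {vspace V}, \dim U = m /\ forall v, v \in U -> S v >].
have exP : exists m, P m.
  exists 0%N; apply/asboolP; exists 0%VS; split; first exact: dimv0.
  by move=> v; rewrite memv0 => /eqP ->.
have bP m : P m -> (m <= \dim (fullv : {vspace V}))%N.
  by move=> /asboolP[U [<- _]]; apply: dimvS; exact: subvf.
case: (ex_maxnP exP bP) => m /asboolP[U [dU US]] mmax.
exists U => v; split; first exact: US.
move=> Sv; apply: contraT => vU.
have W : P (\dim (U + <[v]>)%VS).
  apply/asboolP; exists (U + <[v]>)%VS; split => // w /memv_addP[u uU [z zv ->]].
  move: zv => /vlineP[k ->]; apply: SD; first exact: US.
  exact: SZ.
have := mmax _ W; rewrite -dU leqNgt => /negP; case.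
rewrite (ltn_leqif (dimv_leqif_sup (addvSl U <[v]>))).
apply: contra vU => /subvP; apply.
by apply: (subvP (addvSr U <[v]>)); exact: memv_line.
Qed.

Lemma rV_linear_continuous k (W : normedModType R) (L : 'rV[R]_k -> W) :
  linear L -> continuous L.
Proof.
move=> Llin u.
rewrite (funext (fun v => linear_fun_rV v Llin)).
have c (T : topologicalType) (f : T -> 'rV[R]_k) x : {for x, continuous f} ->
    {for x, continuous (fun y => \sum_i f y 0 i *: L (delta_mx 0 i))}.
  move=> cf; apply: cvg_big => [|i _]; first exact: add_continuous.
  apply: cvgZr_tmp.
  apply: (@continuous_comp _ _ _ f (fun v : 'rV[R]_k => v 0 i)) => //.
  exact: coord_continuous.
by apply: (c _ id); exact: cvg_id.
Qed.

(** The scalar product of a matrix Lie algebra S is only specified on S.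
    These coordinates reduce S to a space of row vectors, where all of the
    theory above applies. *)
Lemma cmat_subspace_coord (d : nat) (S : set (cmat R d)) : S 0 ->
  (forall u v, S u -> S v -> S (u + v)) -> (forall a u, S u -> S (a *: u)) ->
  exists k (j : 'rV[R]_k -> cmat R d) (r : cmat R d -> 'rV[R]_k),
    [/\ linear j, linear r, forall u, r (j u) = u, forall u, S (j u) &
        forall v, S v -> j (r v) = v].
Proof.
move=> S0 SD SZ.
have [U hU] := @subspace_vspace (cmat R d) S S0 SD SZ.
exists (\dim U), (fun u : 'rV[R]_(\dim U) => \sum_i u 0 i *: (vbasis U)`_i),
  (fun v => \row_i coord (vbasis U) i v); split.
- move=> a u v; rewrite scaler_sumr -big_split /=; apply: eq_bigr => i _.
  by rewrite !mxE scalerDl scalerA.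
- by move=> a u v; apply/rowP => i; rewrite !mxE linearP.
- move=> u; apply/rowP => i; rewrite mxE coord_sum_free //.
  exact: basis_free (vbasisP U).
- move=> u; apply/hU; apply: memv_suml => i _; apply: memvZ.
  by apply: vbasis_mem; apply: mem_nth; rewrite size_tuple.
- move=> v /hU vU; rewrite {2}(coord_vbasis vU).
  by apply: eq_bigr => i _; rewrite mxE.
Qed.

End coordinates.

Section reduction.
Context {R : realType} (X : manifoldType R) (mu : probability (borel X) R).
Context (F : R -> X -> X) (d k : nat) (S : set (cmat R d)).
Context (ip : cmat R d -> cmat R d -> R) (U : X -> cmat R d -> cmat R d).
Hypothesis ipS : scalar_product S ip.
Hypothesis SB : forall u v, S u -> S v -> S (u - v).
Hypothesis US : forall x u, S u -> S (U x u).
Context (j : 'rV[R]_k -> cmat R d) (r : cmat R d -> 'rV[R]_k).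
Hypothesis (jlin : linear j) (rlin : linear r).
Hypothesis (rj : forall u, r (j u) = u) (Sj : forall u, S (j u)).
Hypothesis jr : forall v, S v -> j (r v) = v.

(** Together with [coord_op], the structure on S read in coordinates. *)
Definition coord_ip (u v : 'rV[R]_k) : R := ip (j u) (j v).
Definition coord_op (x : X) (u : 'rV[R]_k) : 'rV[R]_k := r (U x (j u)).

Lemma coord_ip_scalar : scalar_product setT coord_ip.
Proof.
case: ipS => sym lin pos; split.
- by move=> u v _ _; exact: sym.
- by move=> a u v w _ _ _; rewrite /coord_ip jlin; exact: lin.
- move=> u _ u0; apply: pos => //; apply: contra_neq u0 => ju.
  by rewrite -(rj u) ju -(rj 0) (linear_fun0 jlin).
Qed.

Lemma ker_to_coord q : in_ker_1W mu F S ip U q ->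
  in_ker_1W mu F setT coord_ip coord_op (r \o q).
Proof.
move=> [[Sq mq fq] kq]; split.
  split => //.
    have cr := cmat_linear_continuous rlin.
    exact: (measurableT_comp (continuous_borel_normed cr) mq).
  by move: fq; congr (_ < _)%E; apply: eq_integral => x _; rewrite /coord_ip /= jr.
by apply: ae_mono kq => x; rewrite /W_op /coord_op /= jr // => ->.
Qed.

Lemma ker_of_coord q : in_ker_1W mu F setT coord_ip coord_op q ->
  in_ker_1W mu F S ip U (j \o q).
Proof.
move=> [[_ mq fq] kq]; split.
  have cj := rV_linear_continuous jlin.
  split; [by move=> x; exact: Sj| |exact: fq].
  exact: (measurableT_comp (continuous_borel_normed cj) mq).
apply: ae_mono kq => x; rewrite /W_op /coord_op /= => <-.
by rewrite jr //; exact: US.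
Qed.

Lemma ker_proj_to_coord f p : (forall x, S (f x)) -> is_ker_proj mu F S ip U f p ->
  is_ker_proj mu F setT coord_ip coord_op (r \o f) (r \o p).
Proof.
move=> Sf [kp op]; split; first exact: ker_to_coord.
move=> q kq; rewrite -[RHS](op _ (ker_of_coord kq)) /L2dot.
have Sp : forall x, S (p x) by case: kp => -[].
apply: eq_Rintegral => x _ /=; rewrite /coord_ip -(linear_funB rlin) jr //.
exact: SB.
Qed.

Lemma ker_proj_of_coord f p : (forall x, S (f x)) ->
  is_ker_proj mu F setT coord_ip coord_op (r \o f) p ->
  is_ker_proj mu F S ip U f (j \o p).
Proof.
move=> Sf [kp op]; split; first exact: ker_of_coord.
move=> q kq; rewrite -[RHS](op _ (ker_to_coord kq)) /L2dot.
have Sq : forall x, S (q x) by case: kq => -[].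
by apply: eq_Rintegral => x _ /=; rewrite /coord_ip (linear_funB jlin) !jr.
Qed.

End reduction.

(** * Unitary invariance of the operator norm *)

Section op_norm_invariance.
Context {R : realType} (d : nat).
Local Open Scope sesquilinear_scope.

(** The Hermitian form v^* v is what unitary matrices preserve visibly. *)
Lemma cvec_normE (v : 'cV[R[i]]_d) :
  cvec_norm v = Num.sqrt (complex.Re ((v^t* *m v) 0 0)).
Proof.
rewrite /cvec_norm; congr Num.sqrt.
rewrite mxE raddf_sum /=; apply: eq_bigr => i _.
rewrite !mxE; case: (v i 0) => a b /=.
by rewrite mulNr opprK !expr2.
Qed.

Lemma cvec_norm_unitary (A : 'M[R[i]]_d) (v : 'cV[R[i]]_d) :
  A \is unitarymx -> cvec_norm (A *m v) = cvec_norm v.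
Proof.
move=> uA; rewrite !cvec_normE.
have -> : (A *m v)^t* *m (A *m v) = v^t* *m v.
  rewrite trmx_mul map_mxM -!mulmxA (mulmxA _ A).
  have -> : A^t* *m A = 1%:M.
    by apply: mulmx1C; apply/unitarymxP.
  by rewrite mul1mx.
by [].
Qed.

(** A and its inverse permute the unit ball and preserve the norm of the
    values. *)
Lemma op_norm_Ad_mx (A : 'M[R[i]]_d) (Z : cmat R d) :
  A \is unitarymx -> op_norm (Ad_mx A Z) = op_norm Z.
Proof.
move=> uA; have uAm := unitarymx_unit uA.
have uV : invmx A \is unitarymx by rewrite (invmx_unitary uA) trmxC_unitary uA.
rewrite /op_norm /Ad_mx to_cmatK.
set L := [set _ | _ in _]; set L' := [set _ | _ in _].
suff -> : L = L' by []; rewrite {}/L {}/L'.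
apply/seteqP; split => _ [v /= v1 <-].
  exists (invmx A *m v); first by rewrite /= (cvec_norm_unitary _ uV).
  by rewrite -!mulmxA [RHS](cvec_norm_unitary _ uA).
exists (A *m v); first by rewrite /= (cvec_norm_unitary _ uA).
by rewrite -!mulmxA (mulKmx uAm) (cvec_norm_unitary _ uA).
Qed.

End op_norm_invariance.

(** * Degrees under homomorphisms, cohomology and representations *)

Section degrees.
Context {R : realType} (X : manifoldType R).
Hypothesis X_compact : compact [set: X].
Context (mu : probability (borel X) R) (F : R -> X -> X).
Hypotheses (F_flow : C1_flow F) (F_mu : flow_preserves mu F).

(** A continuous function on a compact space is bounded. *)
Lemma L2_continuous n (ip : 'rV[R]_n -> 'rV[R]_n -> R) (f : X -> 'rV[R]_n) :
  scalar_product setT ip -> continuous f -> L2 mu setT ip f.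
Proof.
move=> ipS cf.
have mf : measurable_fun setT (f : borel X -> borel 'rV[R]_n) by exact: continuous_borel.
apply: L2P => //.
have cN : continuous (fun x => ip (f x) (f x)).
  by move=> x; apply: ip_continuous_comp => //; exact: cf.
have [c _ cmax] : exists2 c, c \in [set: X] &
    forall t, t \in [set: X] -> ip (f t) (f t) <= ip (f c) (f c).
  apply: compact_EVT_max => //; first by exists point.
  exact: continuous_subspaceT.
have := finite_measure_integrable_cst mu (ip (f c) (f c)) measurableT.
apply: le_integrable => //; first by apply/measurable_EFinP; exact: measurable_ip.
move=> x _; rewrite /= lee_fin !ger0_norm ?(ip_ge0 ipS) //.
by apply: cmax; rewrite inE.
Qed.

Let F1m : measurable_fun setT (F 1 : borel X -> borel X).
Proof. by apply: continuous_borel; exact: flow_continuous. Qed.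

Let F1mu (A : set (borel X)) : measurable A -> mu (F 1 @^-1` A) = mu A.
Proof. exact: F_mu. Qed.

Lemma Ad_linear (G : lieGroupType R) (g : G) :
  linear (Ad g : 'rV[R]_(mdim G) -> 'rV[R]_(mdim G)).
Proof. by move=> a u v; rewrite /Ad /tangent_map linearP. Qed.

Section one_group.
Context (G : lieGroupType R) (ip : lieAlg G -> lieAlg G -> R).
Hypothesis ipS : scalar_product setT ip.
Hypothesis ip_Ad : forall (g : G) (u v : lieAlg G), ip (Ad g u) (Ad g v) = ip u v.

Lemma L2_M (phi : X -> G) : Ck_map 1 (atlas X) (atlas G) phi ->
  L2 mu setT ip (M_fun F phi).
Proof. by move=> phiC; apply: L2_continuous => //; exact: continuous_M. Qed.

Lemma degreeP (phi : X -> G) : Ck_map 1 (atlas X) (atlas G) phi ->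
  is_ker_proj mu F setT ip (fun x => Ad (phi x)) (M_fun F phi) (degree mu F ip phi).
Proof.
move=> phiC; apply: (ker_projP F1m F1mu ipS); last exact: L2_M.
by move=> x; exact: Ad_linear.
Qed.

Lemma degree_unique (phi : X -> G) p : Ck_map 1 (atlas X) (atlas G) phi ->
  is_ker_proj mu F setT ip (fun x => Ad (phi x)) (M_fun F phi) p ->
  {ae mu, forall x, degree mu F ip phi x = p x}.
Proof.
move=> phiC hp.
apply: (ker_proj_unique ipS _ (L2_M phiC) (degreeP phiC) hp).
by move=> x; exact: Ad_linear.
Qed.

Lemma measurable_Ad (zeta : X -> G) v : continuous zeta ->
  measurable_fun setT ((fun x => Ad (zeta x) v) : borel X -> borel 'rV[R]_(mdim G)).
Proof.
move=> cz; apply: continuous_borel => x.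
apply: (@continuous_comp _ _ _ zeta (fun g => Ad g v)); first exact: cz.
exact: continuous_Ad.
Qed.

Lemma degree_cohomologous (phi zeta delta : X -> G) :
  Ck_map 1 (atlas X) (atlas G) phi -> Ck_map 1 (atlas X) (atlas G) zeta ->
  Ck_map 1 (atlas X) (atlas G) delta ->
  (forall x, phi x = ((zeta x)^-1 * delta x * zeta (F 1%R x))%g) ->
  {ae mu, forall x : X, degree mu F ip delta x = Ad (zeta x) (degree mu F ip phi x)}.
Proof.
move=> phiC zetaC deltaC coh.
apply: degree_unique => //.
have cz : continuous zeta by case: zetaC.
have czV : continuous (fun x => (zeta x)^-1%g).
  move=> x; apply: (@continuous_comp _ _ _ zeta (fun g : G => (g^-1)%g)); first exact: cz.
  by have [+ _] := @lie_inv_smooth R G 0; apply.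
apply: (ker_proj_intertwine F1m F1mu ipS (U := fun x => Ad (phi x))
  (U' := fun x => Ad (delta x)) (A := fun x => Ad (zeta x))
  (B := fun x => Ad (zeta x)^-1%g) (f := M_fun F phi) (g := M_fun F zeta)).
- by move=> x; exact: Ad_linear.
- by move=> x; exact: Ad_linear.
- by move=> x; exact: Ad_linear.
- by move=> x; exact: Ad_linear.
- by move=> x; exact: ip_Ad.
- by move=> x; exact: ip_Ad.
- by move=> x u; rewrite -AdM mulgV Ad1.
- by move=> x u; rewrite -AdM mulVg Ad1.
- by move=> v; exact: measurable_Ad.
- by move=> v; exact: measurable_Ad.
- by move=> x u; rewrite -!AdM coh !mulgA mulgV mul1g.
- exact: L2_M.
- exact: L2_M.
- exact: L2_M.
- by move=> x; exact: M_cocycle.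
- exact: degreeP.
Qed.

End one_group.

Lemma degree_hom (G' G : lieGroupType R) (ip : lieAlg G -> lieAlg G -> R)
    (ip' : lieAlg G' -> lieAlg G' -> R) (h : G' -> G) (delta : X -> G') :
  scalar_product setT ip ->
  (forall (g : G) (u v : lieAlg G), ip (Ad g u) (Ad g v) = ip u v) ->
  scalar_product setT ip' ->
  (forall (g : G') (u v : lieAlg G'), ip' (Ad g u) (Ad g v) = ip' u v) ->
  lie_hom h -> Ck_map 1 (atlas X) (atlas G') delta ->
  Ck_map 1 (atlas X) (atlas G) (h \o delta) ->
  {ae mu, forall x : X, degree mu F ip (h \o delta) x =
     tangent_map h 1%g (degree mu F ip' delta x)}.
Proof.
move=> ipS ip_Ad ipS' ip_Ad' hh dC hdC.
have p := degreeP ipS' dC.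
apply: degree_unique => //.
have -> : M_fun F (h \o delta) = tangent_map h 1%g \o M_fun F delta.
  by rewrite funeqE => x; exact: M_hom.
apply: (ker_proj_hom ipS' ipS _ _ _ _ _ (L2_M ipS' dC) p).
- by move=> x; exact: ip_Ad'.
- by move=> x u; exists (Ad (delta x)^-1%g u); rewrite -AdM mulgV Ad1.
- by move=> x; exact: ip_Ad.
- by move=> a u v; rewrite /tangent_map linearP.
- by move=> x u; exact: hom_Ad.
Qed.

Section representation.
Context (G : lieGroupType R) (ip : lieAlg G -> lieAlg G -> R).
Hypothesis ipS : scalar_product setT ip.
Hypothesis ip_Ad : forall (g : G) (u v : lieAlg G), ip (Ad g u) (Ad g v) = ip u v.
Context (d : nat) (pi : G -> 'M[R[i]]_d).
Hypothesis pi1 : pi 1%g = 1%:M.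
Hypothesis piM : forall x y, pi (x * y)%g = pi x *m pi y.
Hypothesis piC : Ck_map 1 (atlas G) (vec_atlas (cmat R d)) (fun g => to_cmat (pi g)).
Local Notation S := (mx_lieAlg (range pi)).
Context (ip_pi : cmat R d -> cmat R d -> R).
Hypothesis ip_piS : scalar_product S ip_pi.
Hypothesis ip_pi_Ad : forall (g : G) (u v : cmat R d), S u -> S v ->
  ip_pi (Ad_mx (pi g) u) (Ad_mx (pi g) v) = ip_pi u v.
Local Notation dpi := (tangent_map_vec (fun g : G => to_cmat (pi g)) 1%g).

(** The projection in the matrix Lie algebra S is obtained from the one in the
    Lie algebra of G, so its existence need not be proved separately; only its
    uniqueness is used, in coordinates on S. *)
Lemma degree_mx_rep (phi : X -> G) : Ck_map 1 (atlas X) (atlas G) phi ->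
  {ae mu, forall x : X, degree_mx mu F S ip_pi (pi \o phi) x =
     dpi (degree mu F ip phi x)}.
Proof.
move=> phiC.
have SD := mx_lieAlgD piM. have SZ := mx_lieAlgZ (rho := pi).
have SB u v : S u -> S v -> S (u - v).
  by move=> Su Sv; apply: SD => //; rewrite -scaleN1r; exact: SZ.
have S0 := mx_lieAlg0 pi1.
have SAd (x : X) u : S u -> S (Ad_mx ((pi \o phi) x) u).
  by move=> Su; exact: mx_lieAlg_Ad.
have Sd v : S (dpi v) by exact: mx_lieAlg_tangent.
have [k [j [r [jlin rlin rj Sj jr]]]] := cmat_subspace_coord S0 SD SZ.
pose ipk := coord_ip ip_pi j.
pose Uk := coord_op (fun x => Ad_mx ((pi \o phi) x)) j r.
have ipkS : scalar_product setT ipk by exact: (coord_ip_scalar ip_piS jlin rj Sj).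
have Uklin x : linear (Uk x).
  by move=> a u v; rewrite /Uk /coord_op jlin Ad_mx_linear rlin.
have Ukip x u v : ipk (Uk x u) (Uk x v) = ipk u v.
  by rewrite /ipk /Uk /coord_op /coord_ip !jr; [exact: ip_pi_Ad|exact: SAd..].
pose T u := r (dpi u) : 'rV[R]_k.
have Tlin : linear T.
  by move=> a u v; rewrite /T /tangent_map_vec linearP rlin.
have TU x u : T (Ad (phi x) u) = Uk x (T u).
  by rewrite /T /Uk /coord_op jr // (rep_Ad_mx pi1 piM piC).
have ME : M_mx F (pi \o phi) = dpi \o M_fun F phi.
  by rewrite funeqE => x; exact: (M_mx_rep pi1 piM piC).
have SM x : S (M_mx F (pi \o phi) x) by rewrite ME; exact: Sd.
have Usurj (x : X) (u : lieAlg G) : exists v, Ad (phi x) v = u.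
  by exists (Ad (phi x)^-1%g u); rewrite -AdM mulgV Ad1.
have Uip (x : X) (u v : lieAlg G) : ip (Ad (phi x) u) (Ad (phi x) v) = ip u v.
  exact: ip_Ad.
have hk := ker_proj_hom ipS ipkS Uip Usurj Ukip Tlin TU (L2_M ipS phiC)
  (degreeP ipS phiC).
have E : T \o M_fun F phi = r \o M_mx F (pi \o phi) by rewrite ME.
have hS : is_ker_proj mu F S ip_pi (fun x => Ad_mx ((pi \o phi) x))
    (M_mx F (pi \o phi)) (j \o (T \o degree mu F ip phi)).
  by apply: (ker_proj_of_coord SAd jlin rlin) => //; rewrite -E.
have hD : is_ker_proj mu F S ip_pi (fun x => Ad_mx ((pi \o phi) x))
    (M_mx F (pi \o phi)) (degree_mx mu F S ip_pi (pi \o phi)).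
  exact: (xgetPex (cst 0) (ex_intro _ _ hS)).
have hDk : is_ker_proj mu F setT ipk Uk (r \o M_mx F (pi \o phi))
    (r \o degree_mx mu F S ip_pi (pi \o phi)).
  exact: (ker_proj_to_coord SB SAd jlin rlin Sj jr SM hD).
have LM : L2 mu setT ipk (r \o M_mx F (pi \o phi)).
  rewrite -E; apply: (L2_hom ipS ipkS Tlin); exact: L2_M.
rewrite E in hk.
apply: ae_mono (ker_proj_unique ipkS Uklin LM hDk hk) => x /= e.
have SD' : S (degree_mx mu F S ip_pi (pi \o phi) x) by case: hD => -[[]].
by rewrite -(jr _ SD') e /T jr.
Qed.

End representation.
End degrees.

Theorem lemma3p8 (R : realType) (X : manifoldType R)
  (X_compact : compact [set: X]) (mu : probability (borel X) R)
  (F : R -> X -> X) (F_flow : C1_flow F) (F_mu : flow_preserves mu F)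
  (G : lieGroupType R) (G_compact : compact [set: G])
  (ip : lieAlg G -> lieAlg G -> R) (ip_scalar : scalar_product setT ip)
  (ip_Ad : forall (g : G) (u v : lieAlg G), ip (Ad g u) (Ad g v) = ip u v)
  (d : nat) (pi : G -> 'M[R[i]]_d) (pi_irrep : unitary_irrep pi)
  (ip_pi : cmat R d -> cmat R d -> R)
  (ip_pi_scalar : scalar_product (mx_lieAlg (range pi)) ip_pi)
  (ip_pi_Ad : forall (g : G) (u v : cmat R d),
     mx_lieAlg (range pi) u -> mx_lieAlg (range pi) v ->
     ip_pi (Ad_mx (pi g) u) (Ad_mx (pi g) v) = ip_pi u v)
  (phi : X -> G) (phi_C1 : Ck_map 1 (atlas X) (atlas G) phi) :
  [/\ (* (a) *)
      forall (G' : lieGroupType R) (ip' : lieAlg G' -> lieAlg G' -> R)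
        (h : G' -> G) (delta : X -> G'),
        compact [set: G'] -> scalar_product setT ip' ->
        (forall (g : G') (u v : lieAlg G'),
           ip' (Ad g u) (Ad g v) = ip' u v) ->
        lie_hom h -> Ck_map 1 (atlas X) (atlas G') delta ->
        phi = h \o delta ->
        {ae mu, forall x : X, degree mu F ip phi x =
           tangent_map h 1%g (degree mu F ip' delta x)},
      (* (b) *)
      forall zeta delta : X -> G,
        Ck_map 1 (atlas X) (atlas G) zeta ->
        Ck_map 1 (atlas X) (atlas G) delta ->
        (forall x, phi x = ((zeta x)^-1 * delta x * zeta (F 1%R x))%g) ->
        {ae mu, forall x : X, degree mu F ip delta x =
           Ad (zeta x) (degree mu F ip phi x)} /\
        {ae mu, forall x : X, ip_norm ip (degree mu F ip delta x) =
           ip_norm ip (degree mu F ip phi x)},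
      (* (c) *)
      forall (G' : lieGroupType R) (ip' : lieAlg G' -> lieAlg G' -> R)
        (h : G' -> G) (delta : X -> G'),
        compact [set: G'] -> scalar_product setT ip' ->
        (forall (g : G') (u v : lieAlg G'),
           ip' (Ad g u) (Ad g v) = ip' u v) ->
        lie_hom h -> Ck_map 1 (atlas X) (atlas G') delta ->
        phi = h \o delta ->
        {ae mu, forall x : X,
           degree_mx mu F (mx_lieAlg (range pi)) ip_pi (pi \o phi) x =
           tangent_map_vec (fun g : G' => to_cmat (pi (h g))) 1%g
             (degree mu F ip' delta x)} &
      (* (d) *)
      forall zeta delta : X -> G,
        Ck_map 1 (atlas X) (atlas G) zeta ->
        Ck_map 1 (atlas X) (atlas G) delta ->
        (forall x, phi x = ((zeta x)^-1 * delta x * zeta (F 1%R x))%g) ->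
        {ae mu, forall x : X,
           degree_mx mu F (mx_lieAlg (range pi)) ip_pi (pi \o delta) x =
           Ad_mx (pi (zeta x))
             (degree_mx mu F (mx_lieAlg (range pi)) ip_pi (pi \o phi) x)} /\
        {ae mu, forall x : X,
           op_norm (degree_mx mu F (mx_lieAlg (range pi)) ip_pi
                      (pi \o delta) x) =
           op_norm (degree_mx mu F (mx_lieAlg (range pi)) ip_pi
                      (pi \o phi) x)}].
Proof.
have [_ pi_unitary piM pi_smooth _] := pi_irrep.
have piC := pi_smooth 1.
have pi1 : pi 1%g = 1%:M.
  have u : pi 1%g \in unitmx by exact: unitarymx_unit.
  by rewrite -[LHS](mulKmx u) -piM mulg1 mulVmx.
have hom (G' : lieGroupType R) (ip' : lieAlg G' -> lieAlg G' -> R)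
    (h : G' -> G) (delta : X -> G') :
    scalar_product setT ip' ->
    (forall (g : G') (u v : lieAlg G'), ip' (Ad g u) (Ad g v) = ip' u v) ->
    lie_hom h -> Ck_map 1 (atlas X) (atlas G') delta -> phi = h \o delta ->
    {ae mu, forall x : X, degree mu F ip phi x =
       tangent_map h 1%g (degree mu F ip' delta x)}.
  move=> ipS' ip_Ad' hh dC phiE; rewrite phiE in phi_C1 *.
  exact: (degree_hom X_compact F_flow F_mu ip_scalar ip_Ad ipS' ip_Ad' hh dC
    phi_C1).
have rep (psi : X -> G) : Ck_map 1 (atlas X) (atlas G) psi ->
    {ae mu, forall x : X, degree_mx mu F (mx_lieAlg (range pi)) ip_pi (pi \o psi) x =
       tangent_map_vec (fun g : G => to_cmat (pi g)) 1%g (degree mu F ip psi x)}.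
  move=> psiC; exact: (degree_mx_rep X_compact F_flow F_mu ip_scalar ip_Ad pi1 piM piC
    ip_pi_scalar ip_pi_Ad psiC).
have coh zeta delta : Ck_map 1 (atlas X) (atlas G) zeta ->
    Ck_map 1 (atlas X) (atlas G) delta ->
    (forall x, phi x = ((zeta x)^-1 * delta x * zeta (F 1%R x))%g) ->
    {ae mu, forall x : X, degree mu F ip delta x = Ad (zeta x) (degree mu F ip phi x)}.
  move=> zC dC.
  exact: (degree_cohomologous X_compact F_flow F_mu ip_scalar ip_Ad phi_C1 zC dC).
split.
- move=> G' ip' h delta _; exact: hom.
- move=> zeta delta zC dC e; have c := coh _ _ zC dC e; split => //.
  by apply: ae_mono c => x ->; rewrite /ip_norm ip_Ad.
- move=> G' ip' h delta _ ipS' ip_Ad' hh dC phiE.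
  have both := ae_and (rep _ phi_C1) (hom _ _ _ _ ipS' ip_Ad' hh dC phiE).
  apply: ae_mono both => x [-> ->].
  exact: (esym (rep_hom piC _ hh)).
- move=> zeta delta zC dC e.
  have c : {ae mu, forall x : X,
      degree_mx mu F (mx_lieAlg (range pi)) ip_pi (pi \o delta) x =
      Ad_mx (pi (zeta x)) (degree_mx mu F (mx_lieAlg (range pi)) ip_pi (pi \o phi) x)}.
    apply: ae_mono (ae_and (ae_and (rep _ dC) (rep _ phi_C1)) (coh _ _ zC dC e)).
    by move=> x [[-> ->] ->]; rewrite (rep_Ad_mx pi1 piM piC).
  split => //.
  by apply: ae_mono c => x ->; rewrite op_norm_Ad_mx.
Qed.
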